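(* Let $(M,\omega,\mathbb{T})$ be a compact symplectic toric manifold of real dimension $2m$. Let $J\in DGK_\omega^{\mathbb{T}}(M)$, with associated coordinates $(\mu^j,t^j)$ on $\mathring M$ in which $$J=\sum_{i,j}\Psi_{ij}\frac{\partial}{\partial t^i}\otimes d\mu^j-\sum_{i,j}(\Psi^{-1})_{ij}\frac{\partial}{\partial\mu^i}\otimes dt^j,$$ and let $\mathring J\in DGK_\omega^{\mathbb{T}}(\mathring M)$ be given in the same coordinates by $$\mathring J=\sum_{i,j}\mathring\Psi_{ij}\frac{\partial}{\partial t^i}\otimes d\mu^j-\sum_{i,j}(\mathring\Psi^{-1})_{ij}\frac{\partial}{\partial\mu^i}\otimes dt^j.$$ Put $\beta=\omega(\cdot,J\cdot)$. If (C1) $\mathring\Psi-\Psi$ admits a smooth extension to $\Delta$; (C2) $\Psi^T\mathring\Psi^{-1}\Psi-\Psi^T$ admits a smooth extension to $\Delta$; (C3) the bilinear form $\beta+\sum_{i,j=1}^m\left[(\mathring\Psi-\Psi)_{ij}\,d\mu^i\otimes d\mu^j+(\Psi^T\mathring\Psi^{-1}\Psi-\Psi^T)_{ij}\,(Jd\mu^i)\otimes(Jd\mu^j)\right]$ is positive definite on $M\setminus\mathring M$; then $\mathring J$ is the restriction to $\mathring M$ of an element of $DGK_\omega^{\mathbb{T}}(M)$.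
   Context: Toric setting. $M$ is compact connected, $\mathbb{T}$ is an $m$-torus with Lie algebra $\mathfrak{t}$ acting effectively and in a hamiltonian fashion on $(M,\omega)$ with moment map $\mu:M\to\mathfrak{t}^*$; $\Delta=\mu(M)$ is the moment polytope, $\mathring\Delta$ its interior, $\mathring M=\mu^{-1}(\mathring\Delta)$ (dense, open). A basis $(\xi_j)$ of $\mathfrak{t}$ is fixed; $K_j=\xi_j^\sharp$ is the induced vector field, $\mu^j=\langle\mu,\xi_j\rangle$, $\omega(K_j,\cdot)=-d\mu^j$. A function on $\Delta$ is smooth if it is the restriction of a smooth function on $\mathfrak{t}^*$; $\mathbb{T}$-invariant smooth functions on $M$ (resp. $\mathring M$) are identified with smooth functions on $\Delta$ (resp. $\mathring\Delta$) via $\mu$. The matrices $\Psi,\mathring\Psi$ are regarded as functions on $\mathring\Delta$; in (C3) the coefficient matrices denote the extensions from (C1), (C2). Structures (with $N=M$ or $\mathring M$). $J$ is $\omega$-tamed if $\omega(X,JX)>0$ for $X\ne0$; $J^{*_\omega}$ is defined by $\omega(JX,Y)=\omega(X,J^{*_\omega}Y)$. Generalized Kähler structures of symplectic type are identified with $\omega$-tamed almost complex structures $J$ such that both $J$ and $J^{*_\omega}$ are integrable; $GK_\omega^{\mathbb{T}}(N)$ is the set of $\mathbb{T}$-invariant ones on $N$. With $\mathcal{K}$ the distribution on $\mathring M$ spanned by the $K_j$, $DGK_\omega^{\mathbb{T}}(N)=\{J\in GK_\omega^{\mathbb{T}}(N):J^{*_\omega}\mathcal{K}=J\mathcal{K}\text{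 on }\mathring M\}$. Coordinates associated with $J\in DGK_\omega^{\mathbb{T}}(M)$: around each point of $\mathring M$ there are local $J$-holomorphic coordinates $u^j+it^j$ with $\partial/\partial u^j=-JK_j$, $\partial/\partial t^j=K_j$; replacing the $u^j$ by the $\mu^j$ gives coordinates $(\mu^j,t^j)$, in which $\omega=\sum_jd\mu^j\wedge dt^j$ and in which $J$ has the displayed anti-diagonal form. The fields $\partial/\partial\mu^j,\partial/\partial t^j$ and forms $d\mu^j,dt^j$ are globally defined on $\mathring M$. $J$ acts on 1-forms by $J\alpha=-\alpha\circ J$. *)

(* Defs.v *)
From HB Require Import structures.
From mathcomp Require Import all_boot all_order all_algebra.
From mathcomp Require Import all_classical all_reals all_analysis.

Set Implicit Arguments.
Unset Strict Implicit.
Unset Printing Implicit Defensive.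
Import Order.TTheory GRing.Theory Num.Theory.
Import numFieldNormedType.Exports.
Local Open Scope classical_set_scope.
Local Open Scope ring_scope.

(* C^k on an open set U; meaningful when V is finite-dimensional, which is the
   only case used below: there, f is C^(k+1) on U exactly when it is
   differentiable on U and all its directional derivatives are C^k on U. *)
Fixpoint Ck (R : realType) (V W : normedModType R) (k : nat)
    (U : set V) (f : V -> W) : Prop :=
  match k with
  | 0 => forall x, U x -> {for x, continuous f}
  | k'.+1 => (forall x, U x -> differentiable f x) /\
             (forall v : V, Ck k' U ('D_v f : V -> W))
  end.

Definition smooth_on (R : realType) (V W : normedModType R)
    (U : set V) (f : V -> W) : Prop := forall k, Ck k U f.

(* A smooth atlas of dimension n on M.  [icoord i] is the inverse of the chart
   [coord i : dom i -> 'rV_n]; its values outside [coord i @` dom i] are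
   irrelevant.  [chart_at p] selects a chart around p; this choice only serves
   to represent the elements of T_pM, see below.  Separation axioms are
   required separately. *)
Record manifold (R : realType) (n : nat) (M : topologicalType) := Manifold {
  chart : Type;
  dom : chart -> set M;
  coord : chart -> M -> 'rV[R]_n;
  icoord : chart -> 'rV[R]_n -> M;
  chart_at : M -> chart;
  dom_chart_at : forall p, dom (chart_at p) p;
  open_dom : forall i, open (dom i);
  open_coord : forall i, open (coord i @` dom i);
  coordK : forall i p, dom i p -> icoord i (coord i p) = p;
  coord_continuous : forall i p, dom i p -> {for p, continuous (coord i)};
  icoord_continuous : forall i x,
    (coord i @` dom i) x -> {for x, continuous (icoord i)};
  transition_smooth : forall i j,
    smooth_on (coord i @` (dom i `&` dom j)) (coord j \o icoord i)
}.

Section Tensors.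
Context {R : realType} {n : nat} {M : topologicalType} (X : manifold R n M).

(* A tangent vector at p is represented by the row vector of its components in
   the chart [chart_at X p].  Thus a vector field is a map M -> 'rV_n, a field
   of endomorphisms J (acting by v |-> v *m J p) or of bilinear forms is a map
   M -> 'M_n. *)
Definition base (p : M) : 'rV[R]_n := coord (chart_at X p) p.

Definition dmap (W : normedModType R) (f : M -> W) (p : M) (v : 'rV[R]_n) : W :=
  'd (f \o icoord (chart_at X p)) (base p) v.

Definition tangent_map (f : M -> M) (p : M) : 'M[R]_n :=
  jacobian (coord (chart_at X (f p)) \o f \o icoord (chart_at X p)) (base p).

(* Change of components of tangent vectors at p, from [chart_at X p] to i. *)
Definition to_chart (i : chart X) (p : M) : 'M[R]_n :=
  jacobian (coord i \o icoord (chart_at X p)) (base p).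

Definition endo_in_chart (i : chart X) (J : M -> 'M[R]_n) (x : 'rV[R]_n) :=
  let p := icoord i x in
  invmx (to_chart i p) *m J p *m to_chart i p.

Definition form_in_chart (i : chart X) (b : M -> 'M[R]_n) (x : 'rV[R]_n) :=
  let p := icoord i x in
  invmx (to_chart i p) *m b p *m (invmx (to_chart i p))^T.

Definition chart_image (i : chart X) (W : set M) : set 'rV[R]_n :=
  coord i @` (dom i `&` W).

Definition smooth_map (V : normedModType R) (W : set M) (f : M -> V) : Prop :=
  forall i, smooth_on (chart_image i W) (f \o icoord i).

Definition smooth_endo (W : set M) (J : M -> 'M[R]_n) : Prop :=
  forall i, smooth_on (chart_image i W) (endo_in_chart i J).

Definition smooth_form (W : set M) (b : M -> 'M[R]_n) : Prop :=
  forall i, smooth_on (chart_image i W) (form_in_chart i b).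

Definition bil (b : 'M[R]_n) (v v' : 'rV[R]_n) : R := (v *m b *m v'^T) 0 0.

Definition posdef (b : 'rV[R]_n -> 'rV[R]_n -> R) : Prop :=
  forall v, v != 0 -> 0 < b v v.

Definition closed_form (w : M -> 'M[R]_n) : Prop :=
  forall i x, chart_image i setT x -> forall a b c : 'I_n,
    'D_(delta_mx 0 a) (fun y => form_in_chart i w y b c) x +
    'D_(delta_mx 0 b) (fun y => form_in_chart i w y c a) x +
    'D_(delta_mx 0 c) (fun y => form_in_chart i w y a b) x = 0.

Definition symplectic_form (w : M -> 'M[R]_n) : Prop :=
  [/\ smooth_form setT w,
      forall p, (w p)^T = - w p,
      forall p, w p \in unitmx &
      closed_form w].

Definition bracket (V V' : 'rV[R]_n -> 'rV[R]_n) (x : 'rV[R]_n) : 'rV[R]_n :=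
  'D_(V x) V' x - 'D_(V' x) V x.

Definition nijenhuis (A : 'rV[R]_n -> 'M[R]_n) (V V' : 'rV[R]_n -> 'rV[R]_n)
    (x : 'rV[R]_n) : 'rV[R]_n :=
  let AV y := V y *m A y in
  let AV' y := V' y *m A y in
  bracket AV AV' x - bracket AV V' x *m A x - bracket V AV' x *m A x
  - bracket V V' x.

Definition integrable_on (W : set M) (J : M -> 'M[R]_n) : Prop :=
  forall i (V V' : 'rV[R]_n -> 'rV[R]_n),
    smooth_on (chart_image i W) V -> smooth_on (chart_image i W) V' ->
    forall x, chart_image i W x -> nijenhuis (endo_in_chart i J) V V' x = 0.

Definition almost_complex_on (W : set M) (J : M -> 'M[R]_n) : Prop :=
  smooth_endo W J /\ forall p, W p -> J p *m J p = - 1%:M.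

(* The adjoint J^{*_w}; its defining property is [adjointP]. *)
Definition adjoint (w J : M -> 'M[R]_n) (p : M) : 'M[R]_n :=
  (invmx (w p) *m J p *m w p)^T.

Lemma bil_ext (b b' : 'M[R]_n) :
  (forall v v', bil b v v' = bil b' v v') -> b = b'.
Proof.
move=> h; apply/matrixP => i j.
have := h (delta_mx 0 i) (delta_mx 0 j).
by rewrite /bil trmx_delta -!rowE -!colE !mxE.
Qed.

Lemma adjointP (w J : M -> 'M[R]_n) (p : M) (K : 'M[R]_n) :
  w p \in unitmx ->
  (forall v v', bil (w p) (v *m J p) v' = bil (w p) v (v' *m K)) <->
  K = adjoint w J p.
Proof.
move=> wu.
have E v v' : bil (w p) (v *m J p) v' = bil (J p *m w p) v v'.
  by rewrite /bil !mulmxA.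
have E' v v' : bil (w p) v (v' *m K) = bil (w p *m K^T) v v'.
  by rewrite /bil trmx_mul !mulmxA.
split=> [h|Kdef v v'].
  have {}h : J p *m w p = w p *m K^T.
    by apply: bil_ext => v v'; rewrite -E h E'.
  by rewrite /adjoint -mulmxA h mulKmx// trmxK.
by rewrite E E' Kdef /adjoint trmxK -!mulmxA mulKVmx.
Qed.

(* Y is a smooth chart with domain U, compatible with the atlas. *)
Definition local_coordinates (U : set M) (Y : M -> 'rV[R]_n) : Prop :=
  [/\ open U, smooth_map U Y, open (Y @` U) &
      exists Z : 'rV[R]_n -> M,
        [/\ forall q, U q -> Z (Y q) = q,
            forall x, (Y @` U) x -> {for x, continuous Z} &
            forall i : chart X,
              smooth_on [set x | (Y @` U) x /\ dom i (Z x)] (coord i \o Z)]].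

(* The coordinate vector field d/dY^k: the basis dual to dY^1, ..., dY^n. *)
Definition coord_field (Y : M -> 'rV[R]_n) (k : 'I_n) (q : M) : 'rV[R]_n :=
  row k (invmx (jacobian (Y \o icoord (chart_at X q)) (base q))).

End Tensors.

Section Toric.
Context {R : realType} {m : nat} {M : topologicalType}.
Context (X : manifold R (m + m) M).
Local Notation tensor := (M -> 'M[R]_(m + m)) (only parsing).

(* The torus is R^m / Z^m, with Lie algebra t = 'rV_m; an action of it is an
   action of (t, +) for which Z^m acts trivially.  The dual t^* is 'cV_m. *)
Definition pairing (l : 'cV[R]_m) (x : 'rV[R]_m) : R := (x *m l) 0 0.

Definition smooth_action (act : 'rV[R]_m -> M -> M) : Prop :=
  continuous (fun z : 'rV[R]_m * M => act z.1 z.2) /\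
  forall i j : chart X,
    smooth_on
      [set z : 'rV[R]_m * 'rV[R]_(m + m) |
        chart_image i setT z.2 /\ dom j (act z.1 (icoord i z.2))]
      (fun z => coord j (act z.1 (icoord i z.2))).

Definition effective_torus_action (act : 'rV[R]_m -> M -> M) : Prop :=
  [/\ smooth_action act,
      forall p, act 0 p = p,
      forall a b p, act (a + b) p = act a (act b p) &
      forall a, (forall p, act a p = p) <->
                exists z : 'rV[int]_m, a = map_mx (fun k : int => k%:~R) z].

Definition fundamental_field (act : 'rV[R]_m -> M -> M) (x : 'rV[R]_m) (p : M) :
    'rV[R]_(m + m) :=
  derive1 (fun s : R => coord (chart_at X p) (act (s *: x) p)) 0.

Definition moment_map (w : tensor) (act : 'rV[R]_m -> M -> M) (mu : M -> 'cV[R]_m) :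
    Prop :=
  [/\ smooth_map X setT mu,
      forall a p, mu (act a p) = mu p &
      forall x p v, bil (w p) (fundamental_field act x p) v =
                    - dmap X (fun q => pairing (mu q) x) p v].

Definition invariant_form (act : 'rV[R]_m -> M -> M) (w : tensor) : Prop :=
  forall a p, tangent_map X (act a) p *m w (act a p) *m
              (tangent_map X (act a) p)^T = w p.

Definition invariant_endo (act : 'rV[R]_m -> M -> M) (W : set M) (J : tensor) :
    Prop :=
  forall a p, W p ->
    J p *m tangent_map X (act a) p = tangent_map X (act a) p *m J (act a p).

(* Second countability follows from compactness. *)
Definition compact_symplectic_toric (w : tensor) (act : 'rV[R]_m -> M -> M)
    (mu : M -> 'cV[R]_m) : Prop :=
  [/\ [/\ hausdorff_space M, compact [set: M] & connected [set: M]],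
      symplectic_form X w,
      effective_torus_action act,
      invariant_form act w &
      moment_map w act mu].

Definition polytope (mu : M -> 'cV[R]_m) : set 'cV[R]_m := range mu.

Definition open_part (mu : M -> 'cV[R]_m) : set M :=
  mu @^-1` interior (polytope mu).

Definition tamed_on (w : tensor) (W : set M) (J : tensor) : Prop :=
  forall p, W p -> posdef (fun v v' => bil (w p) v (v' *m J p)).

Definition GK (w : tensor) (act : 'rV[R]_m -> M -> M) (W : set M) (J : tensor) : Prop :=
  [/\ almost_complex_on X W J,
      tamed_on w W J,
      integrable_on X W J,
      integrable_on X W (adjoint w J) &
      invariant_endo act W J].

(* The rows xi_1, ..., xi_m of xi form the chosen basis of t. *)
Definition Kfield (act : 'rV[R]_m -> M -> M) (xi : 'M[R]_m) (j : 'I_m) (p : M) :=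
  fundamental_field act (row j xi) p.

Definition mucoord (mu : M -> 'cV[R]_m) (xi : 'M[R]_m) (p : M) : 'rV[R]_m :=
  \row_j pairing (mu p) (row j xi).

Definition Kdistribution (act : 'rV[R]_m -> M -> M) (xi : 'M[R]_m) (p : M) :
    'M[R]_(m, m + m) :=
  \matrix_j Kfield act xi j p.

Definition DGK (w : tensor) (act : 'rV[R]_m -> M -> M) (mu : M -> 'cV[R]_m)
    (xi : 'M[R]_m) (W : set M) (J : tensor) : Prop :=
  GK w act W J /\
  forall p, open_part mu p ->
    (Kdistribution act xi p *m adjoint w J p :=:
     Kdistribution act xi p *m J p)%MS.

(* J-holomorphic coordinates u^j + i t^j on U with d/du^j = - J K_j and
   d/dt^j = K_j, for which (mu^j, t^j) are again coordinates. *)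
Definition associated_coordinates (act : 'rV[R]_m -> M -> M)
    (mu : M -> 'cV[R]_m) (xi : 'M[R]_m) (J : tensor) (U : set M)
    (u t : M -> 'rV[R]_m) : Prop :=
  let ut q := row_mx (u q) (t q) in
  let mt q := row_mx (mucoord mu xi q) (t q) in
  [/\ U `<=` open_part mu,
      local_coordinates X U ut,
      forall q v, U q ->
        dmap X u q (v *m J q) = - dmap X t q v /\
        dmap X t q (v *m J q) = dmap X u q v,
      forall q j, U q ->
        coord_field X ut (lshift m j) q = - (Kfield act xi j q *m J q) /\
        coord_field X ut (rshift m j) q = Kfield act xi j q &
      local_coordinates X U mt].

(* J = sum P_ij d/dt^i (x) dmu^j - sum (P^-1)_ij d/dmu^i (x) dt^j at q. *)
Definition antidiagonal_at (mu : M -> 'cV[R]_m) (xi : 'M[R]_m)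
    (t : M -> 'rV[R]_m) (P : 'M[R]_m) (J : tensor) (q : M) : Prop :=
  let mt q' := row_mx (mucoord mu xi q') (t q') in
  forall v,
    v *m J q =
      \sum_i \sum_j (P i j * dmap X (fun q' => mucoord mu xi q' 0 j) q v)
         *: coord_field X mt (rshift m i) q
    - \sum_i \sum_j (invmx P i j * dmap X (fun q' => t q' 0 j) q v)
         *: coord_field X mt (lshift m i) q.

(* A, restricted to D, is a smooth extension to D of F : interior D -> W. *)
Definition smooth_extension (W : normedModType R) (D : set 'cV[R]_m)
    (F A : 'cV[R]_m -> W) : Prop :=
  smooth_on setT A /\ forall x, interior D x -> A x = F x.

Definition dmu (mu : M -> 'cV[R]_m) (xi : 'M[R]_m) (i : 'I_m) (p : M)
    (v : 'rV[R]_(m + m)) : R :=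
  dmap X (fun q => mucoord mu xi q 0 i) p v.

Definition Jform (J : tensor) (p : M) (a : 'rV[R]_(m + m) -> R)
    (v : 'rV[R]_(m + m)) : R := - a (v *m J p).

Definition corrected_form (w : tensor) (mu : M -> 'cV[R]_m) (xi : 'M[R]_m) (J : tensor)
    (A B : 'cV[R]_m -> 'M[R]_m) (p : M) (v v' : 'rV[R]_(m + m)) : R :=
  bil (w p) v (v' *m J p) +
  \sum_i \sum_j
    (A (mu p) i j * (dmu mu xi i p v * dmu mu xi j p v') +
     B (mu p) i j *
       (Jform J p (dmu mu xi i p) v * Jform J p (dmu mu xi j p) v')).

End Toric.

(* Main.v *)
(** In the frame (d/dmu, d/dt) the endomorphism J0 is obtained from J by adding
    two terms that only involve the differentials of the moment coordinates and
    the matrices of (C1) and (C2).  This gives a formula which makes sense on all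
    of M and defines a smooth extension K of J0; the form of (C3) is exactly
    w(., K .), so that K is tamed.  The remaining conditions (K^2 = -1,
    integrability of K and of its adjoint) are closed conditions which hold on
    the open part, hence it suffices that the open part be dense.

    Density: if the moment map is a submersion at p then p lies in the open part.
    Otherwise p is fixed by a one-parameter subgroup, hence by a nontrivial
    element of order 2 of the torus.  There are finitely many of these, and the
    fixed-point set of each one has empty interior: near a limit p of interior
    fixed points, an involution f has derivative 1, thus g = f - id is
    1/2-Lipschitz near p, while g o f = - g; so g vanishes near p, and
    connectedness would make f trivial, against effectiveness. *)

From Pilot Require Import Defs.
From HB Require Import structures.
From mathcomp Require Import all_boot all_order all_algebra.
From mathcomp Require Import all_classical all_reals all_analysis.
From mathcomp Require Import ring lra zify.
(* Once more, so that [coord] is the field of [manifold] and not vector.coord. *)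
Import Pilot.Defs.

Set Implicit Arguments.
Unset Strict Implicit.
Unset Printing Implicit Defensive.
Import Order.TTheory GRing.Theory Num.Theory.
Import numFieldNormedType.Exports.
Local Open Scope classical_set_scope.
Local Open Scope ring_scope.

(** * Calculus of C^k maps *)

(** [g] is [f] plus a function vanishing near [x]; the latter satisfies the little-o condition with
    linear part 0, and uniqueness of the differential concludes. *)
Lemma near_eq_diff (R : realType) (V W : normedModType R) (f g : V -> W) x :
  (\near x, f x = g x) -> differentiable f x ->
  differentiable g x /\ forall v, 'd g x v = 'd f x v.
Proof.
move=> fg df.
have E : g = f + (g - f) by rewrite addrC subrK.
have e0 : \forall y \near x, (g - f) y = 0.
  by near=> y; rewrite /= !fctE (near fg y)// subrr.
have sh : (fun h : V => h + x) @ 0 --> x.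
  by rewrite -[X in _ --> X]add0r; apply: cvgD => //; exact: cvg_cst.
have key : differentiable (g - f) x /\ 'd (g - f) x = 0 :> (V -> W).
  have lin0 : linear (0 : V -> W) by move=> a u v; rewrite scaler0 addr0.
  pose M0 := GRing.isLinear.Build _ _ _ _ (0 : V -> W) lin0.
  pose L0 : {linear V -> W} := HB.pack (0 : V -> W) M0.
  have c0 : continuous L0 by move=> ?; exact: cst_continuous.
  have e1 : (g - f) \o shift x = cst ((g - f) x) + L0 +o_ 0 id.
    apply/eqaddoP => _/posnumP[e]; near=> h.
    have -> : ((g - f) \o shift x - (cst ((g - f) x) + L0)) h =
        (g - f) (h + x) - ((g - f) x + 0) by [].
    rewrite (nbhs_singleton e0).
    have -> : (g - f) (h + x) = 0.
      by near: h; exact: (sh _ e0).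
    by rewrite addr0 subrr normr0 mulr_ge0.
  have e2 := diff_unique c0 e1.
  split; last by rewrite e2.
  by apply/diff_locallyP; rewrite e2; split.
case: key => d0 E0; split.
  by rewrite E; exact: differentiableD.
move=> v.
have Ev : 'd (f + (g - f)) x v = 'd f x v + 'd (g - f) x v.
  exact (congr1 (fun h : V -> W => h v) (diffD df d0)).
have fgg : f + (g - f) = g by rewrite addrC subrK.
move: Ev; rewrite fgg => ->.
by rewrite E0 addr0.
Unshelve. all: by end_near. Qed.

Section Ck.
Context {R : realType}.

Section Basics.
Context {V W : normedModType R}.
Implicit Types (U : set V) (f g : V -> W).

Lemma derive_eq_on U f g v x : open U -> (forall y, U y -> f y = g y) -> U x ->
  'D_v f x = 'D_v g x.
Proof.
move=> oU fg Ux; apply: near_eq_derive.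
by near=> y; apply: fg; near: y; exact: open_nbhs_nbhs.
Unshelve. all: by end_near. Qed.

(** Since [U] is open, the equality holds near each of its points and so passes to directional
    derivatives. *)
Lemma Ck_eq k U f g : open U -> (forall x, U x -> f x = g x) ->
  Ck k U f -> Ck k U g.
Proof.
elim: k f g => [|k IH] f g oU fg /=.
  move=> cf x Ux; have nU : nbhs x U by exact: open_nbhs_nbhs.
  change (g @ x --> g x); rewrite -(fg _ Ux).
  apply: cvg_trans (cf x Ux); apply: near_eq_cvg.
  by near=> y; rewrite fg//; near: y.
move=> [df Df]; split=> [x Ux|v].
  apply: (near_eq_diff _ (df x Ux)).1.
  by near=> y; apply: fg; near: y; exact: open_nbhs_nbhs.
by apply: IH (Df v) => // x Ux; exact: (derive_eq_on v oU fg Ux).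
Unshelve. all: by end_near. Qed.

Lemma Ck_sub k U U' f : U `<=` U' -> Ck k U' f -> Ck k U f.
Proof.
elim: k f => [|k IH] f UU' /=; first by move=> cf x /UU'; exact: cf.
by move=> [df Df]; split=> [x /UU'|v]; [exact: df | exact: IH].
Qed.

Lemma CkW k U f : Ck k.+1 U f -> Ck k U f.
Proof.
elim: k f => [|k IH] f [df Df].
  by move=> x Ux; apply: differentiable_continuous; exact: df.
by split=> // v; exact: IH.
Qed.

Lemma Ck_cst k U (c : W) : Ck k U (cst c).
Proof.
elim: k c => [|k IH] c /=; first by move=> x _; exact: cst_continuous.
split=> [x _|v]; first exact: differentiable_cst.
rewrite (_ : 'D_v _ = cst 0); first exact: IH.
by apply/funext => x; rewrite derive_cst.
Qed.

Lemma CkD k U f g : open U -> Ck k U f -> Ck k U g ->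
  Ck k U (fun x => f x + g x).
Proof.
move=> oU; elim: k f g => [|k IH] f g /=.
  by move=> cf cg x Ux; apply: continuousD; [exact: cf|exact: cg].
move=> [df Df] [dg Dg]; split=> [x Ux|v].
  by apply: differentiableD; [exact: df|exact: dg].
apply: Ck_eq (IH _ _ (Df v) (Dg v)) => // x Ux.
by rewrite deriveD//; apply: diff_derivable; [exact: df|exact: dg].
Qed.

Lemma Ck_sum k U (I : Type) (r : seq I) (P : pred I) (F : I -> V -> W) :
  open U -> (forall i, P i -> Ck k U (F i)) ->
  Ck k U (fun x => \sum_(i <- r | P i) F i x).
Proof.
move=> oU CF; elim: r => [|i r IH].
  by apply: Ck_eq (Ck_cst k U 0) => // x _; rewrite big_nil.
case Pi: (P i).
  by apply: Ck_eq (CkD oU (CF _ Pi) IH) => // x _; rewrite big_cons Pi.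
by apply: Ck_eq IH => // x _; rewrite big_cons Pi.
Qed.

End Basics.

Lemma CkM {V : normedModType R} k (U : set V) (f g : V -> R) : open U ->
  Ck k U f -> Ck k U g -> Ck k U (fun x => f x * g x).
Proof.
move=> oU; elim: k f g => [|k IH] f g.
  by move=> cf cg x Ux; apply: continuousM; [exact: cf|exact: cg].
move=> Cf Cg; have [df Df] := Cf; have [dg Dg] := Cg; split=> [x Ux|v].
  by apply: differentiableM; [exact: df|exact: dg].
apply: Ck_eq (CkD oU (IH _ _ (CkW Cf) (Dg v)) (IH _ _ (CkW Cg) (Df v))) => // x Ux.
by rewrite deriveM//; apply: diff_derivable; [exact: df|exact: dg].
Qed.

Lemma Ck_prod {V : normedModType R} k (U : set V) (I : Type) (r : seq I)
    (F : I -> V -> R) :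
  open U -> (forall i, Ck k U (F i)) -> Ck k U (fun x => \prod_(i <- r) F i x).
Proof.
move=> oU CF; elim: r => [|i r IH].
  by apply: Ck_eq (Ck_cst k U (1 : R)) => // x _; rewrite big_nil.
by apply: Ck_eq (CkM oU (CF i) IH) => // x _; rewrite big_cons.
Qed.

(** The derivative of the inverse is [- f^-1 * f^-1 * 'D_v f], to which the induction hypothesis and
    the product rule apply. *)
Lemma CkV {V : normedModType R} k (U : set V) (f : V -> R) : open U ->
  (forall x, U x -> f x != 0) -> Ck k U f -> Ck k U (fun x => (f x)^-1).
Proof.
move=> oU f0; elim: k => [|k IH].
  by move=> cf x Ux; apply: continuousV; [exact: f0|exact: cf].
move=> Cf; have [df Df] := Cf; split=> [x Ux|v].
  by apply: differentiableV; [exact: df|exact: f0].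
have CV := IH (CkW Cf).
apply: Ck_eq (CkM oU (CkM oU (Ck_cst k U (-1 : R)) (CkM oU CV CV)) (Df v)) => // x Ux.
rewrite deriveV ?f0//; last by apply: diff_derivable; exact: df.
by rewrite /cst -expr2 exprVn mulN1r.
Qed.

Section Matrices.
Context {V : normedModType R} {a b : nat}.
Implicit Types (U : set V) (f : V -> 'M[R]_(a, b)).

Lemma derive_entry f v x i j : differentiable f x ->
  'D_v f x i j = 'D_v (fun y => f y i j) x.
Proof. by move=> df; rewrite derive_mx ?mxE//; exact: diff_derivable. Qed.

Lemma differentiable_entry f x i j : differentiable f x ->
  differentiable (fun y => f y i j) x.
Proof.
by move=> df; apply: (differentiable_comp df (differentiable_coord (f x) i j)).
Qed.

Lemma differentiable_mx f x : (forall i j, differentiable (fun y => f y i j) x) ->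
  differentiable f x.
Proof.
move=> df.
rewrite (_ : f = \sum_i \sum_j (fun y => f y i j *: delta_mx i j)); last first.
  apply/funext => y; rewrite fct_sumE [LHS]matrix_sum_delta.
  by apply: eq_bigr => i _; rewrite fct_sumE.
by apply: differentiable_sum => i; apply: differentiable_sum => j;
  apply: differentiableZl.
Qed.

Lemma continuous_entry f x i j : {for x, continuous f} ->
  {for x, continuous (fun y => f y i j)}.
Proof. 
move=> cf; exact: (@continuous_comp _ _ _ f (fun M : 'M[R]_(a, b) => M i j) x cf
  (@matrix_normedtype.coord_continuous _ _ _ i j _)).
 Qed.

Lemma continuous_mx f x : (forall i j, {for x, continuous (fun y => f y i j)}) ->
  {for x, continuous f}.
Proof.
move=> cf; apply/cvgrPdist_le => /= e e0; near=> y.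
rewrite /Num.Def.normr/= mx_normrE (bigmax_le _ (ltW e0))//= => i _.
rewrite !mxE/=; move: i; near: y; apply: filter_forall => /= i.
exact: ((cvgrPdist_le _ _).1 (cf i.1 i.2)).
Unshelve. all: by end_near. Qed.

(** Reduces the regularity of matrix-valued maps to that of scalar functions, which can be
    multiplied and inverted. *)
Lemma Ck_mxP k U f : open U ->
  Ck k U f <-> forall i j, Ck k U (fun x => f x i j).
Proof.
move=> oU; elim: k f => [|k IH] f.
  split=> [cf i j x Ux|cf x Ux]; first by apply: continuous_entry; exact: cf.
  by apply: continuous_mx => i j; exact: cf.
split=> [[df Df] i j|Cf].
  split=> [x Ux|v]; first by apply: differentiable_entry; exact: df.
  apply: Ck_eq ((IH _).1 (Df v) i j) => // x Ux.
  by rewrite derive_entry//; exact: df.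
have df x : U x -> differentiable f x.
  by move=> Ux; apply: differentiable_mx => i j; apply: (Cf i j).1.
split=> // v; apply/IH => i j; apply: Ck_eq ((Cf i j).2 v) => // x Ux.
by rewrite derive_entry//; exact: df.
Qed.

End Matrices.

Lemma derive_comp (V V' W : normedModType R) (f : V -> V') (g : V' -> W) v x :
  differentiable f x -> differentiable g (f x) ->
  'D_v (g \o f) x = 'd g (f x) ('D_v f x).
Proof.
move=> df dg; rewrite (deriveE _ df) deriveE; last exact: differentiable_comp.
by rewrite (diff_comp df dg).
Qed.

Lemma diff_entries a b (W : normedModType R) (g : 'M[R]_(a, b) -> W) x v :
  differentiable g x ->
  'd g x v = \sum_i \sum_j v i j *: 'D_(delta_mx i j) g x.
Proof.
move=> dg; rewrite [v in LHS]matrix_sum_delta linear_sum; apply: eq_bigr => i _.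
rewrite linear_sum; apply: eq_bigr => j _.
by rewrite linearZ/= deriveE.
Qed.

Section MatrixOps.
Context {V : normedModType R}.
Implicit Types (U : set V).

Lemma Ck_mulmx k U a b c (f : V -> 'M[R]_(a, b)) (g : V -> 'M[R]_(b, c)) :
  open U -> Ck k U f -> Ck k U g -> Ck k U (fun x => f x *m g x).
Proof.
move=> oU /(Ck_mxP _ _ oU) Cf /(Ck_mxP _ _ oU) Cg; apply/(Ck_mxP _ _ oU) => i j.
apply: (@Ck_eq _ _ _ _ (fun x => \sum_l f x i l * g x l j)) => //.
  by move=> x _; rewrite mxE.
by apply: Ck_sum => // l _; exact: CkM.
Qed.

Lemma Ck_trmx k U a b (f : V -> 'M[R]_(a, b)) :
  open U -> Ck k U f -> Ck k U (fun x => (f x)^T).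
Proof.
move=> oU /(Ck_mxP _ _ oU) Cf; apply/(Ck_mxP _ _ oU) => i j.
by apply: Ck_eq (Cf j i) => // x _; rewrite mxE.
Qed.

Lemma CkN k U a b (f : V -> 'M[R]_(a, b)) :
  open U -> Ck k U f -> Ck k U (fun x => - f x).
Proof.
move=> oU Cf.
apply: Ck_eq (Ck_mulmx oU (Ck_cst k U (- 1%:M : 'M[R]_a)) Cf) => // x _.
by rewrite mulNmx mul1mx.
Qed.

Lemma CkB k U a b (f g : V -> 'M[R]_(a, b)) :
  open U -> Ck k U f -> Ck k U g -> Ck k U (fun x => f x - g x).
Proof. by move=> oU Cf Cg; apply: CkD => //; exact: CkN. Qed.

Lemma Ck_det k U n (f : V -> 'M[R]_n) : open U -> Ck k U f ->
  Ck k U (fun x => \det (f x)).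
Proof.
move=> oU /(Ck_mxP _ _ oU) Cf; apply: Ck_sum => // s _.
by apply: CkM => //; [exact: Ck_cst | apply: Ck_prod].
Qed.

(** Cramer's formula: each entry of the inverse is a cofactor divided by the determinant. *)
Lemma Ck_invmx k U n (f : V -> 'M[R]_n) : open U ->
  (forall x, U x -> f x \in unitmx) -> Ck k U f -> Ck k U (fun x => invmx (f x)).
Proof.
move=> oU fu Cf; apply/(Ck_mxP _ _ oU) => i j.
apply: (@Ck_eq _ _ _ _ (fun x => (\det (f x))^-1 *
    ((-1) ^+ (j + i) * \det (row' j (col' i (f x)))))) => //.
  by move=> x Ux; rewrite /invmx fu// !mxE.
apply: CkM => //.
  by apply: CkV => //; [move=> x /fu; rewrite unitmxE unitfE | exact: Ck_det].
apply: CkM => //; first exact: Ck_cst.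
apply: Ck_det => //; apply/(Ck_mxP _ _ oU) => i' j'.
by apply: Ck_eq ((Ck_mxP _ _ oU).1 Cf (lift j i') (lift i j')) => // x _; rewrite !mxE.
Qed.

(** By the chain rule, a derivative of [h \o f] is a finite sum of entries of ['D_v f] times partial
    derivatives of [h] composed with [f], so induction on [k] applies. *)
Lemma Ck_comp_scalar k U a b (U' : set 'M[R]_(a, b)) (f : V -> 'M[R]_(a, b))
    (h : 'M[R]_(a, b) -> R) :
  open U -> (forall x, U x -> U' (f x)) ->
  Ck k U f -> Ck k U' h -> Ck k U (h \o f).
Proof.
move=> oU UU'; elim: k h => [|k IH] h Cf Ch.
  by move=> x Ux; apply: continuous_comp; [exact: Cf | apply: Ch; exact: UU'].
have [df Df] := Cf; have [dh Dh] := Ch; split=> [x Ux|v].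
  exact (differentiable_comp (df x Ux) (dh _ (UU' x Ux))).
apply: (@Ck_eq _ _ _ _ (fun x => \sum_p \sum_q
    'D_v f x p q * ('D_(delta_mx p q) h \o f) x)) => //.
  move=> x Ux; have dhx := dh _ (UU' x Ux).
  by rewrite (derive_comp v (df x Ux) dhx) (diff_entries _ dhx).
apply: Ck_sum => // p _; apply: Ck_sum => // q _; apply: CkM => //.
  exact: ((Ck_mxP _ _ oU).1 (Df v)).
exact: IH (CkW Cf) (Dh _).
Qed.

Lemma Ck_comp k U a b c d (U' : set 'M[R]_(a, b)) (f : V -> 'M[R]_(a, b))
    (g : 'M[R]_(a, b) -> 'M[R]_(c, d)) :
  open U -> open U' -> (forall x, U x -> U' (f x)) ->
  Ck k U f -> Ck k U' g -> Ck k U (g \o f).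
Proof.
move=> oU oU' UU' Cf /(Ck_mxP _ _ oU') Cg; apply/(Ck_mxP _ _ oU) => i j.
exact: Ck_comp_scalar (Cg i j).
Qed.

End MatrixOps.
End Ck.

(** * Jacobians, small Lipschitz constants and submersions *)

Lemma near_eq_continuous (T S : topologicalType) (f g : T -> S) x :
  (\near x, f x = g x) -> {for x, continuous f} -> {for x, continuous g}.
Proof.
move=> E cf; change (g @ x --> g x); rewrite -(nbhs_singleton E).
by apply: cvg_trans cf; apply: near_eq_cvg; near=> y; rewrite (near E y).
Unshelve. all: by end_near. Qed.

Section Jacobian.
Context {R : realType}.

Lemma diff_jacobian n k (f : 'rV[R]_n -> 'rV[R]_k) x v :
  'd f x v = v *m jacobian f x.
Proof. by rewrite mul_rV_lin1. Qed.

Lemma derive_jacobian n k (f : 'rV[R]_n -> 'rV[R]_k) x v :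
  differentiable f x -> 'D_v f x = v *m jacobian f x.
Proof. by move=> df; rewrite deriveE// diff_jacobian. Qed.

Lemma jacobianP n k (f : 'rV[R]_n -> 'rV[R]_k) x (A : 'M[R]_(n, k)) :
  (forall v, 'd f x v = v *m A) -> jacobian f x = A.
Proof.
by move=> fA; apply/row_matrixP => i; rewrite !rowE -diff_jacobian fA.
Qed.

Lemma jacobian_comp n k l (f : 'rV[R]_n -> 'rV[R]_k) (g : 'rV[R]_k -> 'rV[R]_l) x :
  differentiable f x -> differentiable g (f x) ->
  jacobian (g \o f) x = jacobian f x *m jacobian g (f x).
Proof.
move=> df dg; apply: jacobianP => v.
by rewrite (diff_comp df dg) /= !diff_jacobian mulmxA.
Qed.

Lemma jacobian_eq n k (f g : 'rV[R]_n -> 'rV[R]_k) x :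
  (\near x, f x = g x) -> differentiable f x -> jacobian g x = jacobian f x.
Proof.
move=> fg df; apply: jacobianP => v.
by rewrite (near_eq_diff fg df).2 diff_jacobian.
Qed.

Lemma jacobian_id n (x : 'rV[R]_n) : jacobian id x = 1%:M.
Proof. by apply: jacobianP => v; rewrite diff_val mulmx1. Qed.

Lemma jacobian_entry n k (f : 'rV[R]_n -> 'rV[R]_k) x i j :
  differentiable f x -> jacobian f x i j = 'D_(delta_mx 0 i) f x 0 j.
Proof. by move=> df; rewrite derive_jacobian// -rowE [in RHS]mxE. Qed.

Lemma Ck_jacobian q n k U (f : 'rV[R]_n -> 'rV[R]_k) : open U ->
  Ck q.+1 U f -> Ck q U (jacobian f).
Proof.
move=> oU [df Df]; apply/(Ck_mxP _ _ oU) => i j.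
apply: Ck_eq ((Ck_mxP _ _ oU).1 (Df (delta_mx 0 i)) 0 j) => // x Ux.
by rewrite jacobian_entry//; exact: df.
Qed.

Lemma rV_norm_le n (v : 'rV[R]_n) (e : R) :
  0 <= e -> (forall j, `|v 0 j| <= e) -> `|v| <= e.
Proof.
move=> e0 ve; rewrite /Num.Def.normr/= mx_normrE (bigmax_le _ e0)//= => -[i j] _.
by rewrite (ord1 i).
Qed.

Lemma rV_norm_ge n (v : 'rV[R]_n) j : `|v 0 j| <= `|v|.
Proof.
rewrite [leRHS]/Num.Def.normr/= mx_normrE.
exact: (le_bigmax _ (fun ij : 'I_1 * 'I_n => `|v ij.1 ij.2|) (0, j)).
Qed.

Lemma is_diff_line (V : normedModType R) (x v : V) (t : R) :
  is_diff t (fun s : R => x + s *: v) (fun s => s *: v).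
Proof.
have [d e] := is_diffD (is_diff_cst x t) (is_diff_scalel t v).
apply: DiffDef; first exact: d.
by rewrite (_ : (fun s => _) = cst x + *:%R^~ v)// e; apply/funext => s /=; rewrite !fctE add0r.
Qed.

(** Mean value inequality: the partial derivatives vanish at [p] and are continuous there, hence are
    small on a ball, which is convex. With the maximum norm, components can be treated one at a
    time. *)
Lemma small_lipschitz n k (f : 'rV[R]_n -> 'rV[R]_k) p (e : R) : 0 < e ->
  (\near p, differentiable f p) ->
  (forall v, {for p, continuous ('D_v f)}) -> (forall v, 'D_v f p = 0) ->
  exists2 r, 0 < r &
    forall x y, ball p r x -> ball p r y -> `|f x - f y| <= e * `|x - y|.
Proof.
move=> e0 df cf f0.
(* Each of the [n] partial derivatives will be bounded by [e / n.+1]; the successor keeps the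
   divisor nonzero when [n = 0]. *)
have n0 : (0 : R) < n.+1%:R by rewrite ltr0n.
have : \forall y \near p, differentiable f y /\
    forall i : 'I_n, `|'D_(delta_mx 0 i) f y| <= e / n.+1%:R.
  near=> y; split; first by near: y.
  move=> i; move: i; near: y; apply: filter_forall => i.
  have /cvgrPdist_le/(_ (e / n.+1%:R)) := cf (delta_mx 0 i).
  rewrite divr_gt0// f0 => /(_ isT).
  by apply: filterS => y; rewrite sub0r normrN.
move=> /nbhs_ballP[r /= r0 Hr]; exists r => // x y px py.
have bd z v : ball p r z -> `|'d f z v| <= e * `|v|.
  move=> /Hr[dz Dz]; rewrite diff_entries// big_ord1.
  apply: le_trans (ler_norm_sum _ _ _) _.
  apply: (@le_trans _ _ (\sum_(i < n) `|v| * (e / n.+1%:R))).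
    apply: ler_sum => i _; rewrite normrZ ler_pM//; exact: rV_norm_ge.
  rewrite sumr_const card_ord -mulrnAr mulrC ler_wpM2r//.
  rewrite -mulr_natr mulrAC -mulrA; apply: ler_piMr; first exact: ltW.
  by rewrite ler_pdivrMr// mul1r ler_nat.
apply: rV_norm_le => [|j]; first by rewrite mulr_ge0// ltW.
(* One component of [f] along the segment from [y] to [x], to which the scalar mean value theorem
   applies. *)
pose h (t : R) := f (y + t *: (x - y)) 0 j.
have bl (t : R) : 0 <= t <= 1 -> ball p r (y + t *: (x - y)).
  move=> /andP[t0 t1]; rewrite -ball_normE /=.
  have -> : p - (y + t *: (x - y)) = t *: (p - x) + (1 - t) *: (p - y).
    by apply/matrixP => ? ?; rewrite !mxE; ring.
  move: px py; rewrite -ball_normE /= => px py.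
  apply: le_lt_trans (ler_normD _ _) _; rewrite !normrZ !ger0_norm ?subr_ge0//.
  have [->|tn0] := eqVneq t 0; first by rewrite mul0r add0r subr0 mul1r.
  have -> : r = t * r + (1 - t) * r by ring.
  rewrite ltr_leD//; first by rewrite ltr_pM2l// lt_neqAle eq_sym tn0.
  by rewrite ler_wpM2l ?subr_ge0// ltW.
have dh (t : R) : 0 <= t <= 1 -> is_derive t 1 h ('d f (y + t *: (x - y)) (x - y) 0 j).
  move=> t01; have [d1 e1] := is_diff_line y (x - y) t.
  have df1 := (Hr _ (bl t t01)).1.
  have d2 := differentiable_comp d1 df1.
  apply: DeriveDef.
    by apply: diff_derivable; apply: differentiable_entry d2.
  rewrite -(derive_entry (1 : R) 0 j d2) (derive_comp (1 : R) d1 df1) deriveE// e1.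
  by rewrite scale1r.
have [||t t01] := @MVT_segment R h (fun t => 'd f (y + t *: (x - y)) (x - y) 0 j) 0 1 ler01.
- by move=> t; rewrite in_itv /= => /andP[t0 t1]; apply: dh; rewrite !ltW.
- apply: derivable_within_continuous => t; rewrite in_itv /= => t01.
  by have [] := dh t t01.
rewrite /h scale1r scale0r addr0 subr0 mulr1 [y + _]addrC subrK => ht.
rewrite mxE [X in _ + X]mxE ht.
apply: le_trans (rV_norm_ge _ _) (bd _ _ _).
by apply: bl; move: t01; rewrite in_itv.
Unshelve. all: by end_near. Qed.

Lemma continuous_mulmxr n k l (C : 'M[R]_(k, l)) : continuous (fun z : 'M[R]_(n, k) => z *m C).
Proof.
move=> z; apply: differentiable_continuous; apply: differentiable_mx => i j.
rewrite (_ : (fun y => _) = \sum_q (fun y : 'M[R]_(n, k) => y i q * C q j)); last first.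
  by apply/funext => y; rewrite fct_sumE mxE.
by apply: differentiable_sum => q; apply: differentiableM => //;
  exact: differentiable_coord.
Qed.

Lemma is_diff_mulmxr n k l (C : 'M[R]_(k, l)) (z : 'M[R]_(n, k)) :
  is_diff z (mulmxr C) (mulmxr C).
Proof.
have c : continuous (mulmxr C : 'M[R]_(n, k) -> _) := @continuous_mulmxr n k l C.
by apply: DiffDef; [exact: linear_differentiable | rewrite diff_lin].
Qed.

Lemma jacobian_mulmxr n k l (f : 'rV[R]_n -> 'rV[R]_k) (C : 'M[R]_(k, l)) x :
  differentiable f x -> differentiable (fun y => f y *m C) x /\
  jacobian (fun y => f y *m C) x = jacobian f x *m C.
Proof.
move=> df; have [d e] := is_diff_mulmxr C (f x).
split; first exact: (differentiable_comp df d).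
apply: jacobianP => v.
have h : 'd (fun y => f y *m C) x v = 'd (mulmxr C) (f x) ('d f x v).
  exact (congr1 (fun h => h v) (diff_comp df d)).
by rewrite h e /= diff_jacobian mulmxA.
Qed.

(** On the affine slice [p + z *m L] the map has derivative 1 at 0. Hence [g], its difference with a
    translation, is a contraction near 0, and [f (a z) = w] becomes the fixed-point equation
    [z = (w - f p) - g z]. *)
Lemma submersion_nbhs n k (f : 'rV[R]_n -> 'rV[R]_k) p (L : 'M[R]_(k, n)) :
  (\near p, differentiable f p) -> (forall v, {for p, continuous ('D_v f)}) ->
  L *m jacobian f p = 1%:M -> nbhs (f p) (range f).
Proof.
move=> df cf Lf.
pose a (z : 'rV[R]_k) : 'rV[R]_n := p + z *m L.
have da z : is_diff z a (fun v => v *m L).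
  have [d e] := is_diffD (is_diff_cst p z) (is_diff_mulmxr L z).
  apply: DiffDef; first exact: d.
  by rewrite (_ : a = cst p + mulmxr L)// e; apply/funext => v /=; rewrite !fctE add0r.
have ca z : {for z, continuous a} by have [d _] := da z; exact: differentiable_continuous.
have a0 : a 0 = p by rewrite /a mul0mx addr0.
pose g (z : 'rV[R]_k) : 'rV[R]_k := f (a z) - f p - z.
have dfa : \forall z \near (0 : 'rV[R]_k), differentiable f (a z).
  have h : a z @[z --> (0 : 'rV[R]_k)] --> a 0 := ca 0.
  by rewrite a0 in h; exact: (h _ df).
have dg z : differentiable f (a z) -> differentiable g z /\
    forall v, 'D_v g z = 'D_(v *m L) f (a z) - v.
  move=> dfz; have [d1 e1] := da z.
  have d2 := differentiable_comp d1 dfz.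
  have d3 : differentiable ((f \o a) - cst (f p)) z by exact: differentiableB.
  split=> [|v]; first by apply: (differentiableB d3).
  rewrite -[g]/((f \o a) - cst (f p) - id) deriveB//; [|exact: diff_derivable..].
  rewrite deriveB//; [|exact: diff_derivable..].
  by rewrite derive_cst subr0 derive_id derive_comp// deriveE// e1 -deriveE.
have [||v|v|r r0 gr] := @small_lipschitz k k g 0 (2^-1) _.
- by rewrite invr_gt0 ltr0n.
- by near=> z; apply: (dg _ _).1; near: z.
- have c1 : {for (0 : 'rV[R]_k), continuous (fun z => 'D_(v *m L) f (a z) - v)}.
    apply: continuousB; last exact: cst_continuous.
    have c0 : {for a 0, continuous ('D_(v *m L) f)} by rewrite a0.
    exact: (@continuous_comp _ _ _ a ('D_(v *m L) f) 0 (ca 0) c0).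
  have E : \forall z \near (0 : 'rV[R]_k), 'D_(v *m L) f (a z) - v = 'D_v g z.
    by near=> z; rewrite (dg _ _).2//; near: z.
  exact: near_eq_continuous E c1.
- rewrite (dg _ _).2; last exact: (nbhs_singleton dfa).
  rewrite a0 derive_jacobian; last exact: (nbhs_singleton df).
  by rewrite -mulmxA Lf mulmx1 subrr.
have g0 : g 0 = 0 by rewrite /g a0 subrr subr0.
(* A closed ball inside the ball of radius [r]. On it [g] is bounded by [r / 4], so for [w] within
   [r / 4] of [f p] the map [T] below preserves it. *)
pose U := [set z : 'rV[R]_k | `|z| <= r / 2].
have Ur z : U z -> ball 0 r z.
  rewrite /U -ball_normE /= sub0r normrN => /le_lt_trans; apply.
  by rewrite ltr_pdivrMr// ltr_pMr// ltr1n.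
have gU z : U z -> `|g z| <= r / 4.
  move=> Uz; have := gr z 0 (Ur _ Uz) (ballxx _ r0).
  rewrite g0 !subr0 => /le_trans; apply.
  by move: Uz; rewrite /U /=; lra.
apply/nbhs_ballP; exists (r / 4) => /=; first by rewrite divr_gt0.
move=> w; rewrite -ball_normE /= => wr.
pose T z := (w - f p) - g z.
have TU : {homo T : z / U z >-> U z}.
  move=> z Uz; rewrite /U/T /=; apply: le_trans (ler_normB _ _) _.
  have := gU z Uz; rewrite distrC in wr; lra.
pose Tf := mkfun_fun TU.
pose X : completeNormedModType R :=
  HB.pack 'rV[R]_k (Uniform_isComplete.Build 'rV[R]_k (@mx_complete R 1 k)).
have [|||z Uz Tz] := @banach_fixed_point R X U Tf.
- exists (NngNum (ltW (divr_gt0 ltr01 (ltr0n R 2)))); split => /=.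
    by rewrite ltr_pdivrMr// mul1r ltr1n.
  move=> [x y] /= [Ux Uy].
  have -> : T x - T y = - (g x - g y).
    by apply/matrixP => i j; rewrite !mxE; ring.
  by rewrite normrN div1r; apply: gr; exact: Ur.
- have -> : U = closed_ball_ (fun x => `|x|) 0 (r / 2).
    by apply/seteqP; split=> z; rewrite /U/closed_ball_ /= sub0r normrN.
  exact: closed_closed_ball_.
- by exists 0; rewrite /U /= normr0 divr_ge0 ?ltW.
exists (a z) => //.
have : z = (w - f p) - (f (a z) - f p - z) by [].
move=> E; apply/eqP; rewrite -subr_eq0; apply/eqP.
have := congr1 (fun y => z - y) E; rewrite /= subrr => E0; rewrite [RHS]E0.
by apply/matrixP => i j; rewrite !mxE; ring.
Unshelve. all: by end_near. Qed.

End Jacobian.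

(** * Half-integral points of closed subgroups of R^m *)

Section HalfPeriods.
Context {R : realType} {m : nat}.

(** Dirichlet's pigeonhole argument: among [N.+1 ^ m + 1] multiples of [x], two have their
    fractional parts in the same box of side [1 / N.+1]. *)
Lemma simultaneous_approximation (x : 'rV[R]_m) (N : nat) : x != 0 ->
  exists t : R, exists2 z : 'rV[int]_m, z != 0 &
    forall j, `|t * x 0 j - (z 0 j)%:~R| < N.+1%:R^-1.
Proof.
move=> x0.
have [k xk] : exists k, x 0 k != 0.
  apply: contrapT => /forallNP h; move/eqP: x0; apply; apply/rowP => j.
  by rewrite mxE; apply/eqP; apply: contrapT => /negP; exact: h.
(* With this step, two distinct multiples differ by at least 2 in the coordinate [k], which forces
   the integral vector [z] to be nonzero. *)
pose T := 2 / `|x 0 k|.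
pose y (i : nat) j := i%:R * T * x 0 j.
pose fr (i : nat) j : R := y i j - (Num.floor (y i j))%:~R.
pose c i j := Num.truncn (N.+1%:R * fr i j).
have fr0 i j : 0 <= fr i j by rewrite subr_ge0 floor_le_tmp.
have fr1 i j : fr i j < 1.
  by rewrite ltrBlDl -intrD1 floorD1_gt.
have cN i j : (c i j < N.+1)%N.
  rewrite -(ltr_nat R); apply: (@le_lt_trans _ _ (N.+1%:R * fr i j)).
    by rewrite truncn_le mulr_ge0.
  by rewrite -[ltRHS]mulr1 ltr_pM2l.
pose F (i : 'I_(N.+1 ^ m).+1) : {ffun 'I_m -> 'I_N.+1} := [ffun j => Ordinal (cN i j)].
have [i1 [i2 i12 Fi]] : exists i1, exists2 i2, i1 != i2 & F i1 = F i2.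
  apply: contrapT => h.
  have /leq_card : injective F.
    move=> i1 i2 Fi; apply/eqP; apply: contrapT => /negP i12.
    by apply: h; exists i1, i2.
  by rewrite card_ffun !card_ord ltnn.
have d j : `|fr i1 j - fr i2 j| < N.+1%:R^-1.
  have : c i1 j = c i2 j.
    by have := congr1 (fun f : {ffun 'I_m -> 'I_N.+1} => val (f j)) Fi; rewrite !ffunE.
  rewrite /c => e.
  have a1 := truncn_itv (mulr_ge0 (ler0n R N.+1) (fr0 i1 j)).
  have a2 := truncn_itv (mulr_ge0 (ler0n R N.+1) (fr0 i2 j)).
  rewrite -e in a2; move: a1 a2 => /andP[a1 b1] /andP[a2 b2].
  rewrite -(@ltr_pM2l _ N.+1%:R)// mulfV// -[X in X * _]ger0_norm// -normrM.
  rewrite mulrBr; set q := Num.truncn _ in a1 a2 b1 b2.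
  have q1 : q.+1%:R = q%:R + 1 :> R by rewrite natr1.
  rewrite q1 in b1 b2.
  by rewrite ltr_norml; apply/andP; split; lra.
exists ((i1%:R - i2%:R) * T).
pose z : 'rV[int]_m := \row_j (Num.floor (y i1 j) - Num.floor (y i2 j)).
have zE j : (i1%:R - i2%:R) * T * x 0 j - (z 0 j)%:~R = fr i1 j - fr i2 j.
  by rewrite mxE rmorphB /fr /y /=; ring.
exists z; last by move=> j; rewrite zE.
apply/eqP => z0; have := zE k; rewrite z0 mxE subr0 => e.
have := d k; rewrite -e -mulrA normrM /T normrM normrM normfV normr_id.
rewrite divfK ?normr_eq0// [`|2|]ger0_norm// => h.
have h1 : N.+1%:R^-1 <= 1 :> R by rewrite invf_le1// ler1n.
suff : 1 <= `|i1%:R - i2%:R| :> R by move: h h1; move: (N.+1%:R^-1) `|_| => q a; lra.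
move: i12; rewrite neq_ltn => /orP[] i12.
  rewrite distrC ger0_norm ?subr_ge0 ?ler_nat 1?ltnW// lerBrDr -(natrD _ 1%N).
  by rewrite ler_nat add1n.
rewrite ger0_norm ?subr_ge0 ?ler_nat 1?ltnW// lerBrDr -(natrD _ 1%N).
by rewrite ler_nat add1n.
Qed.

(** As long as all entries of [z] are even, [t] and [z] can be halved, which also halves the
    error. *)
Lemma odd_simultaneous_approximation (x : 'rV[R]_m) (N : nat) : x != 0 ->
  exists (t : R) (z : 'rV[int]_m), (exists k, odd (absz (z 0 k))) /\
    forall j, `|t * x 0 j - (z 0 j)%:~R| < N.+1%:R^-1.
Proof.
move=> x0; have [t [z z0 tz]] := simultaneous_approximation N x0.
have [k zk] : exists k, z 0 k != 0.
  apply: contrapT => /forallNP h; move/eqP: z0; apply; apply/rowP => j.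
  by rewrite mxE; apply/eqP; apply: contrapT => /negP; exact: h.
(* Induction on a bound for the absolute value of the nonzero entry [z 0 k], which decreases
   strictly at each halving. *)
move: (leqnn (absz (z 0 k))); move: {2}(absz _) => n.
elim: n t z zk tz {z0} => [|n IH] t z zk tz.
  by rewrite leqn0 absz_eq0 (negbTE zk).
have [odd_z _|/forallNP even_z zn] := pselect (exists k, odd (absz (z 0 k))).
  by exists t, z.
have div2 j : z 0 j = (z 0%R j %/ 2)%Z * 2.
  by apply/eqP; rewrite eq_sym -dvdz_eq dvdzE /= dvdn2; apply/negP/even_z.
pose z' : 'rV[int]_m := \row_j (z 0%R j %/ 2)%Z.
have z'E j : z 0 j = z' 0 j * 2 by rewrite mxE -div2.
have z'k : z' 0 k != 0.
  by apply: contraNneq zk => e; rewrite z'E e mul0r.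
apply: (IH (t / 2) z') => // [j|].
  have := tz j; rewrite z'E rmorphM /= => h.
  apply: le_lt_trans h.
  have -> : t * x 0 j - (z' 0 j)%:~R * 2%:~R = (t / 2 * x 0 j - (z' 0 j)%:~R) * 2.
    by field.
  by rewrite normrM ler_peMr// ger0_norm// ler1n.
move: zn; rewrite z'E abszM; move: z'k; rewrite -absz_eq0.
by lia.
Qed.

(** Representatives of the points of order dividing 2 of the torus, indexed by a finite type;
    [const_mx false] corresponds to the identity. *)
Definition half_vector (b : 'rV[bool]_m) : 'rV[R]_m := \row_j ((b 0 j)%:R / 2).

(* Choose t and z with t x close to z and z not divisible by 2: then (t / 2) x
   lies in S and is, modulo integers, close to one of the finitely many nonzero
   half-integral classes. *)
Lemma closed_subgroup_half_vector (S : set 'rV[R]_m) (x : 'rV[R]_m) :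
  closed S -> (forall a b, S a -> S b -> S (a - b)) ->
  (forall z : 'rV[int]_m, S (map_mx intr z)) ->
  x != 0 -> (forall t, S (t *: x)) -> exists2 b, b != const_mx false & S (half_vector b).
Proof.
move=> cS SB Sz x0 Sx; apply: contrapT => h.
(* If no nonzero half vector is in the closed set [S], then, there being finitely many, all of them
   stay outside [S] under one and the same small perturbation. *)
have : \forall v \near (0 : 'rV[R]_m), forall b, b != const_mx false ->
    ~ S (half_vector b + v).
  apply: (@filter_forall _ _
    (fun b v => b != const_mx false -> ~ S (half_vector b + v))
    (nbhs (0 : 'rV[R]_m)) _) => b.
  have [->|b0] := eqVneq b (const_mx false); first by near=> v.
  have nb : nbhs (half_vector b) (~` S).
    apply: open_nbhs_nbhs; split; first exact: closed_openC.
    by move=> Sb; apply: h; exists b.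
  move: nb => /nbhs_ballP[e /= e0 He]; apply/nbhs_ballP; exists e => //= v.
  rewrite -ball_normE /= sub0r normrN => ve _; apply: He.
  by rewrite -ball_normE /= opprD addrA subrr sub0r normrN.
move=> /nbhs_ballP[r /= r0 Hr].
have [N Nr] : exists N, N.+1%:R^-1 < r.
  exists (Num.truncn (r^-1)).
  by rewrite invf_plt ?posrE// truncnS_gt.
have [t [z [[k zk] tz]]] := odd_simultaneous_approximation N x0.
pose b : 'rV[bool]_m := \row_j odd (absz (z 0 j)).
have b0 : b != const_mx false.
  by apply/eqP => /rowP/(_ k); rewrite !mxE zk.
pose v : 'rV[R]_m := \row_j ((t * x 0 j - (z 0 j)%:~R) / 2).
apply: (Hr v _ b b0).
  rewrite -ball_normE /= sub0r normrN; apply: le_lt_trans Nr.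
  rewrite /Num.Def.normr/= mx_normrE bigmax_le// => -[i j] _.
  rewrite /= (ord1 i) mxE normrM normfV [`|2|]ger0_norm//.
  rewrite ler_pdivrMr//; have := tz j; move: (N.+1%:R^-1) => q.
  by move: (normr_ge0 (t * x 0 j - (z 0 j)%:~R)); lra.
(* Half of [z] is [half_vector b] plus the integral vector [q]; hence [half_vector b + v] is a
   difference of two elements of [S]. *)
pose q : 'rV[int]_m := \row_j ((z 0%R j - (odd (absz (z 0%R j)))%:Z) %/ 2)%Z.
have -> : half_vector b + v = (t / 2) *: x - map_mx intr q; last exact: SB.
apply/rowP => j; rewrite !mxE.
have e : z 0 j = (odd (absz (z 0 j)))%:Z + 2 * ((z 0%R j - (odd (absz (z 0%R j)))%:Z) %/ 2)%Z.
  by lia.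
have := congr1 (fun u : int => u%:~R : R) e; rewrite rmorphD rmorphM /=.
move: (_ %/ _)%Z => u ->.
by rewrite -pmulrn; field.
Unshelve. all: by end_near. Qed.

End HalfPeriods.

(** * Charts *)

Lemma closed_equalizer (T S : topologicalType) (f g : T -> S) :
  hausdorff_space S -> continuous f -> continuous g -> closed [set x | f x = g x].
Proof.
rewrite open_hausdorff => hS cf cg; rewrite -[X in closed X]setCK; apply: open_closedC.
rewrite openE => x /= /eqP /hS [[A B] [/= Ax Bx] [oA oB AB0]].
rewrite inE in Ax; rewrite inE in Bx.
have nA : \forall y \near x, A (f y) by apply: cf; exact: open_nbhs_nbhs.
have nB : \forall y \near x, B (g y) by apply: cg; exact: open_nbhs_nbhs.
near=> y => fgy.
have Ay : A (f y) by near: y.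
have By : B (g y) by near: y.
move/eqP: AB0 => AB0.
have : (A `&` B) (g y) by split=> //; rewrite -fgy.
by rewrite AB0.
Unshelve. all: by end_near. Qed.

Lemma connected_clopen (T : topologicalType) (S : set T) :
  connected [set: T] -> S !=set0 -> open S -> closed S -> S = [set: T].
Proof. by move=> cT S0 oS cS; apply: cT => //; exists S; rewrite ?setTI. Qed.

(** Points are closed in [V]. Identities pass from the open part to the whole manifold in this
    form. *)
Lemma continuous_eq_cst (T : topologicalType) (R : realType) (V : normedModType R)
    (f : T -> V) (c : V) (S : set T) x :
  {for x, continuous f} -> (forall N, nbhs x N -> N `&` S !=set0) ->
  (forall y, S y -> f y = c) -> f x = c.
Proof.
move=> cf NS fS; apply: contrapT => fx.
have : nbhs (f x) (~` [set c]).
  apply: open_nbhs_nbhs; split=> //; apply: closed_openC.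
  exact/accessible_closed_set1/hausdorff_accessible/norm_hausdorff.
by move=> /cf /NS[y [/= + Sy]]; rewrite fS.
Qed.

Section Charts.
Context {R : realType} {n : nat} {M : topologicalType} (X : manifold R n M).

Lemma chart_imageP (i : chart X) (W : set M) y : chart_image i W y ->
  [/\ dom i (icoord i y), W (icoord i y) & coord i (icoord i y) = y].
Proof. by move=> [p [dp Wp] <-]; rewrite coordK. Qed.

Lemma chart_image_coord (i : chart X) (W : set M) p :
  dom i p -> W p -> chart_image i W (coord i p).
Proof. by move=> dp Wp; exists p. Qed.

Lemma near_icoord (i : chart X) p (P : set M) : dom i p -> nbhs p P ->
  \forall y \near coord i p, P (icoord i y).
Proof.
move=> dp nP.
have := @icoord_continuous _ _ _ X i (coord i p) (imageP _ dp).
by rewrite /prop_for /continuous_at coordK//; apply.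
Qed.

Lemma near_coord (i : chart X) p (P : set 'rV[R]_n) : dom i p ->
  nbhs (coord i p) P -> \forall q \near p, P (coord i q).
Proof. by move=> dp; exact: Defs.coord_continuous. Qed.

Lemma near_dom (i : chart X) p : dom i p -> nbhs p (dom i).
Proof. by move=> dp; apply: open_nbhs_nbhs; split=> //; exact: open_dom. Qed.

Lemma near_chart_image (i : chart X) (W : set M) p : dom i p -> nbhs p W ->
  nbhs (coord i p) (chart_image i W).
Proof.
move=> dp nW.
have n1 : nbhs (coord i p) (coord i @` dom i).
  by apply: open_nbhs_nbhs; split; [exact: open_coord | exact: imageP].
have n2 := near_icoord dp nW.
near=> y.
have [q dq qy] : (coord i @` dom i) y by near: y.
exists q => //; split=> //.
rewrite -(coordK dq) qy.
by near: y.
Unshelve. all: by end_near. Qed.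

Lemma open_chart_image (i : chart X) (W : set M) : open W -> open (chart_image i W).
Proof.
move=> oW; rewrite openE => y [p [dp Wp] <-].
by apply: near_chart_image => //; exact: open_nbhs_nbhs.
Qed.

Lemma near_icoord_coord (i : chart X) p : dom i p ->
  \forall y \near coord i p, coord i (icoord i y) = y.
Proof.
move=> dp; have nC : nbhs (coord i p) (chart_image i setT).
  by apply: near_chart_image => //; exact: filterT.
near=> y; have : chart_image i setT y by near: y.
by move=> /chart_imageP[].
Unshelve. all: by end_near. Qed.

Lemma dense_chart_image (i : chart X) (S : set M) y N : dense S ->
  chart_image i setT y -> nbhs y N -> N `&` chart_image i S !=set0.
Proof.
move=> dS [p [dp _] <-] nN.
have : nbhs p (dom i `&` coord i @^-1` N).
  by apply: filterI; [exact: near_dom | exact: near_coord].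
rewrite nbhsE => -[N' [oN' Np] N'sub].
have [q [Nq' Sq]] := dS N' (ex_intro _ p Np) oN'.
have [dq Nq] := N'sub q Nq'.
by exists (coord i q); split=> //; exists q.
Qed.

(** For [i] equal to [chart_at X p] this is [to_chart j p] by conversion. *)
Definition transition (i j : chart X) (p : M) : 'M[R]_n :=
  jacobian (coord j \o icoord i) (coord i p).

Lemma differentiable_transition (i j : chart X) p : dom i p -> dom j p ->
  differentiable (coord j \o icoord i) (coord i p).
Proof.
by move=> dip djp; have [d _] := @transition_smooth _ _ _ X i j 1; apply: d; exists p.
Qed.

Lemma jacobian_transition k (f : M -> 'rV[R]_k) (i j : chart X) p :
  dom i p -> dom j p -> differentiable (f \o icoord j) (coord j p) ->
  differentiable (f \o icoord i) (coord i p) /\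
  jacobian (f \o icoord i) (coord i p) =
    transition i j p *m jacobian (f \o icoord j) (coord j p).
Proof.
move=> dip djp df.
have dt := differentiable_transition dip djp.
have cj : (coord j \o icoord i) (coord i p) = coord j p by rewrite /= coordK.
rewrite -cj in df.
have E : \forall y \near coord i p,
    ((f \o icoord j) \o (coord j \o icoord i)) y = (f \o icoord i) y.
  have := near_icoord dip (near_dom djp).
  by apply: filterS => y dy /=; rewrite coordK.
have dc := differentiable_comp dt df.
split; first exact: (near_eq_diff E dc).1.
rewrite (jacobian_eq E dc).
by have e := jacobian_comp dt df; rewrite cj in e; rewrite -[RHS]e.
Qed.

Lemma transition_comp (i j k : chart X) p : dom i p -> dom j p -> dom k p ->
  transition i k p = transition i j p *m transition j k p.
Proof.
move=> dip djp dkp; rewrite {1}/transition.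
by rewrite (jacobian_transition dip djp (differentiable_transition djp dkp)).2.
Qed.

Lemma transition_id (i : chart X) p : dom i p -> transition i i p = 1%:M.
Proof.
move=> dp; rewrite -(jacobian_id (coord i p)) /transition.
apply: jacobian_eq; last by exact: ex_diff.
by have := near_icoord_coord dp; apply: filterS => y /= ->.
Qed.

(** The cocycle relation from [i] through [j] back to [i] exhibits an inverse. *)
Lemma transition_unit (i j : chart X) p : dom i p -> dom j p ->
  transition i j p \in unitmx.
Proof.
move=> dip djp; have e := transition_comp dip djp dip.
rewrite (transition_id dip) in e.
exact: (mulmx1_unit (esym e)).1.
Qed.

Lemma to_chart_unit (i : chart X) p : dom i p -> to_chart i p \in unitmx.
Proof. by move=> dp; apply: transition_unit => //; exact: dom_chart_at. Qed.

Lemma smooth_map_differentiable k (W : set M) (f : M -> 'rV[R]_k) (i : chart X) p :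
  smooth_map X W f -> dom i p -> W p -> differentiable (f \o icoord i) (coord i p).
Proof.
by move=> sf dp Wp; have [d _] := sf i 1; apply: d; exact: chart_image_coord.
Qed.

Lemma smooth_map_continuous (V : normedModType R) (f : M -> V) :
  smooth_map X setT f -> continuous f.
Proof.
move=> sf p; have dp := dom_chart_at X p.
have c0 := sf (chart_at X p) 0 _ (chart_image_coord dp I).
have E : \forall q \near p, (f \o icoord (chart_at X p)) (coord (chart_at X p) q) = f q.
  by have := near_dom dp; apply: filterS => q dq /=; rewrite coordK.
apply: (near_eq_continuous E).
exact: (@continuous_comp _ _ _ (coord (chart_at X p)) (f \o icoord (chart_at X p)) p
  (Defs.coord_continuous dp) c0).
Qed.

End Charts.

(** * The correction term, smoothness and integrability *)

Section Correction.
Context {F : fieldType} {n m : nat}.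
Implicit Types (J w T : 'M[F]_n) (D : 'M[F]_(n, m)) (A B : 'M[F]_m).

(* The endomorphism K for which w(., K .) is the form of (C3); the columns of D
   are the differentials of the moment coordinates. *)
Definition correction J w D A B : 'M[F]_n :=
  J - (D *m A^T *m D^T + J *m D *m B^T *m D^T *m J^T) *m invmx w.

Lemma invmx_uniq k (C C' : 'M[F]_k) : C *m C' = 1%:M -> invmx C = C'.
Proof.
move=> e; have [Cu _] := mulmx1_unit e.
by rewrite -[LHS]mulmx1 -e mulKmx.
Qed.

Lemma invmx_congruence k (T w : 'M[F]_k) : T \in unitmx -> w \in unitmx ->
  invmx (invmx T *m w *m (invmx T)^T) = T^T *m invmx w *m T.
Proof.
move=> Tu wu; set S := invmx T.
have ST' : S^T *m T^T = 1%:M by rewrite -trmx_mul mulmxV// trmx1.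
apply: invmx_uniq.
rewrite !mulmxA -(mulmxA (S *m w)) ST' mulmx1 -(mulmxA S) mulmxV// mulmx1.
by rewrite mulVmx.
Qed.

(** The correction is tensorial: it is conjugated when [J] changes as an endomorphism, [w] as a
    bilinear form and the columns of [D] as covectors. This serves both for changes of chart and for
    the torus action. *)
Lemma correction_conj J w D A B T : T \in unitmx -> w \in unitmx ->
  correction (invmx T *m J *m T) (invmx T *m w *m (invmx T)^T) (invmx T *m D) A B =
  invmx T *m correction J w D A B *m T.
Proof.
move=> Tu wu; set S := invmx T.
have TS : T *m S = 1%:M by rewrite mulmxV.
have ST' : S^T *m T^T = 1%:M by rewrite -trmx_mul TS trmx1.
rewrite /correction invmx_congruence// mulmxBr mulmxBl; congr (_ - _).
rewrite !mulmxDl !mulmxDr mulmxDl !trmx_mul !mulmxA; congr (_ + _).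
  by rewrite -(mulmxA _ S^T) ST' mulmx1.
rewrite -(mulmxA _ S^T T^T) ST' mulmx1.
by rewrite -(mulmxA _ S^T T^T) ST' mulmx1 -(mulmxA _ T S) TS mulmx1.
Qed.

(** The left side is the matrix of the form [w(., K .)]. Antisymmetry makes [invmx w] change sign
    under transposition, which turns the minus sign of [correction] into a plus. *)
Lemma mul_correction_tr J w D A B : w^T = - w -> w \in unitmx ->
  w *m (correction J w D A B)^T =
  w *m J^T + (D *m A *m D^T + J *m D *m B *m D^T *m J^T).
Proof.
move=> wT wu; rewrite /correction linearB /= mulmxBr trmx_mul trmx_inv wT.
have -> : invmx (- w) = - invmx w.
  by apply: invmx_uniq; rewrite mulmxN mulNmx opprK mulmxV.
by rewrite mulNmx mulmxN opprK mulKVmx// linearD /= !trmx_mul !trmxK !mulmxA.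
Qed.

End Correction.

Lemma Ck_correction (R : realType) (V : normedModType R) k (U : set V) n m
    (J w : V -> 'M[R]_n) (D : V -> 'M[R]_(n, m)) (A B : V -> 'M[R]_m) :
  open U -> (forall x, U x -> w x \in unitmx) ->
  Ck k U J -> Ck k U w -> Ck k U D -> Ck k U A -> Ck k U B ->
  Ck k U (fun x => correction (J x) (w x) (D x) (A x) (B x)).
Proof.
move=> oU wu CJ Cw CD CA CB.
have CDt := Ck_trmx oU CD; have CAt := Ck_trmx oU CA; have CBt := Ck_trmx oU CB.
have CJt := Ck_trmx oU CJ; have Cwi := Ck_invmx oU wu Cw.
apply: (CkB oU CJ); apply: (Ck_mulmx oU _ Cwi); apply: (CkD oU).
  exact: (Ck_mulmx oU (Ck_mulmx oU CD CAt) CDt).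
exact: (Ck_mulmx oU (Ck_mulmx oU (Ck_mulmx oU (Ck_mulmx oU CJ CD) CBt) CDt) CJt).
Qed.

(** * Regularity and locality of the Nijenhuis tensor *)

Section Nijenhuis.
Context {R : realType} {n : nat}.
Implicit Types (V : 'rV[R]_n -> 'rV[R]_n) (A : 'rV[R]_n -> 'M[R]_n) (U : set 'rV[R]_n).

Lemma Ck_bracket k U V V' : open U -> Ck k.+1 U V -> Ck k.+1 U V' ->
  Ck k U (bracket V V').
Proof.
move=> oU CV CV'; have [dV _] := CV; have [dV' _] := CV'.
apply: (@Ck_eq _ _ _ _ _ (fun x => V x *m jacobian V' x - V' x *m jacobian V x)) => //.
  move=> x Ux; rewrite /bracket !derive_jacobian//; [exact: dV|exact: dV'].
by apply: (CkB oU); apply: (Ck_mulmx oU);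
  by [exact: (CkW CV) | exact: (CkW CV') | exact: (Ck_jacobian oU)].
Qed.

Lemma Ck_nijenhuis k U A V V' : open U -> Ck k.+1 U A -> Ck k.+1 U V -> Ck k.+1 U V' ->
  Ck k U (nijenhuis A V V').
Proof.
move=> oU CA CV CV'; have CAV := Ck_mulmx oU CV CA; have CAV' := Ck_mulmx oU CV' CA.
have CA' := CkW CA.
apply: (CkB oU); last exact: Ck_bracket.
apply: (CkB oU); last by apply: (Ck_mulmx oU) => //; exact: Ck_bracket.
apply: (CkB oU); last by apply: (Ck_mulmx oU) => //; exact: Ck_bracket.
exact: Ck_bracket.
Qed.

(** Every derivative involved depends only on the values near [x]. *)
Lemma nijenhuis_eq U A A' V V' x : open U -> (forall y, U y -> A y = A' y) -> U x ->
  nijenhuis A V V' x = nijenhuis A' V V' x.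
Proof.
move=> oU AA' Ux; rewrite /nijenhuis /bracket (AA' _ Ux).
have E (Z : 'rV[R]_n -> 'rV[R]_n) v :
    'D_v (fun y => Z y *m A y) x = 'D_v (fun y => Z y *m A' y) x.
  by apply: (derive_eq_on v oU) => // y Uy; rewrite AA'.
by rewrite !E.
Qed.

End Nijenhuis.

(** * Tensors in charts, and passage to the limit from a dense set *)

Section Tensors.
Context {R : realType} {n : nat} {M : topologicalType} (X : manifold R n M).
Implicit Types (i : chart X).

Lemma endo_in_chart_coord i (J : M -> 'M[R]_n) p : dom i p ->
  endo_in_chart i J (coord i p) = invmx (to_chart i p) *m J p *m to_chart i p.
Proof. by move=> dp; rewrite /endo_in_chart coordK. Qed.

Lemma endo_eq_in_chart i (J J' : M -> 'M[R]_n) p : dom i p ->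
  endo_in_chart i J (coord i p) = endo_in_chart i J' (coord i p) -> J p = J' p.
Proof.
move=> dp; rewrite !endo_in_chart_coord// => e.
have Tu := to_chart_unit dp.
by have := congr1 (fun K => to_chart i p *m K *m invmx (to_chart i p)) e;
  rewrite !mulmxA !mulmxK// mulmxV// !mul1mx.
Qed.

Lemma mul_endo_in_chart i (J J' : M -> 'M[R]_n) y : chart_image i setT y ->
  endo_in_chart i J y *m endo_in_chart i J' y =
  endo_in_chart i (fun p => J p *m J' p) y.
Proof.
move=> /chart_imageP[dp _ _]; rewrite /endo_in_chart !mulmxA.
by rewrite mulmxK//; exact: to_chart_unit.
Qed.

Lemma form_in_chart_unit i (w : M -> 'M[R]_n) y : chart_image i setT y ->
  (forall p, w p \in unitmx) -> form_in_chart i w y \in unitmx.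
Proof.
move=> /chart_imageP[dp _ _] wu; have Tu := to_chart_unit dp.
by rewrite /form_in_chart !unitmx_mul unitmx_tr unitmx_inv Tu wu.
Qed.

Lemma endo_in_chart_adjoint i (w J : M -> 'M[R]_n) y : chart_image i setT y ->
  w (icoord i y) \in unitmx ->
  endo_in_chart i (adjoint w J) y =
  (invmx (form_in_chart i w y) *m endo_in_chart i J y *m form_in_chart i w y)^T.
Proof.
move=> /chart_imageP[dp _ _] wu; have Tu := to_chart_unit dp.
rewrite /endo_in_chart /form_in_chart /adjoint.
set T := to_chart _ _ in Tu *; set S := invmx T.
have TS : T *m S = 1%:M by rewrite mulmxV.
have ST' : S^T *m T^T = 1%:M by rewrite -trmx_mul TS trmx1.
rewrite invmx_congruence// !trmx_mul !trmxK !mulmxA.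
rewrite -(mulmxA _ S^T T^T) ST' mulmx1.
by rewrite -(mulmxA _ S^T T^T) ST' mulmx1.
Qed.

Lemma smooth_adjoint (w J : M -> 'M[R]_n) : smooth_form X setT w ->
  (forall p, w p \in unitmx) -> smooth_endo X setT J -> smooth_endo X setT (adjoint w J).
Proof.
move=> sw wu sJ i k; have oU := open_chart_image (i := i) (@openT M).
have Cw := sw i k; have CJ := sJ i k.
apply: (@Ck_eq _ _ _ _ _ (fun y => (invmx (form_in_chart i w y) *m
    endo_in_chart i J y *m form_in_chart i w y)^T)) => //.
  by move=> y Uy; rewrite endo_in_chart_adjoint.
apply: (Ck_trmx oU); apply: (Ck_mulmx oU) => //; apply: (Ck_mulmx oU) => //.
by apply: (Ck_invmx oU) => // y Uy; exact: form_in_chart_unit.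
Qed.

(** In a chart the Nijenhuis tensor of smooth data is continuous, and it vanishes on the image of
    the dense set [S]. *)
Lemma integrable_dense (S : set M) (J J' : M -> 'M[R]_n) :
  open S -> dense S -> smooth_endo X setT J -> (forall p, S p -> J p = J' p) ->
  integrable_on X S J' -> integrable_on X setT J.
Proof.
move=> oS dS sJ JJ' iJ' i V V' sV sV' x Ux.
have oU := open_chart_image (i := i) (@openT M).
have oU' := open_chart_image (i := i) oS.
have sub : chart_image i S `<=` chart_image i setT by move=> y [p [dp _] <-]; exists p.
have CN := Ck_nijenhuis oU (sJ i 1) (sV 1) (sV' 1).
apply: (continuous_eq_cst (CN x Ux)) => [N nN|y Sy].
  exact: dense_chart_image dS Ux nN.
rewrite (@nijenhuis_eq _ _ _ _ (endo_in_chart i J') _ _ _ oU') //.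
  by apply: iJ' => // k; apply: Ck_sub sub _; [exact: sV | exact: sV'].
by move=> z /chart_imageP[_ Sz _]; rewrite /endo_in_chart JJ'.
Qed.

(** The limit is taken in one fixed chart: the components [J p] refer to [chart_at X p], which
    varies with [p] without any continuity. *)
Lemma almost_complex_dense (S : set M) (J J' : M -> 'M[R]_n) :
  dense S -> smooth_endo X setT J -> (forall p, S p -> J p = J' p) ->
  (forall p, S p -> J' p *m J' p = - 1%:M) -> almost_complex_on X setT J.
Proof.
move=> dS sJ JJ' J'2; split=> // p _.
pose i := chart_at X p; have dp : dom i p := dom_chart_at X p.
have oU := open_chart_image (i := i) (@openT M).
have Up : chart_image i setT (coord i p) by exists p.
have C2 := Ck_mulmx oU (sJ i 0) (sJ i 0).
suff e : endo_in_chart i J (coord i p) *m endo_in_chart i J (coord i p) = - 1%:M.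
  apply: (endo_eq_in_chart (J := fun q => J q *m J q) (J' := fun=> - 1%:M) dp).
  rewrite -mul_endo_in_chart// e /endo_in_chart mulmxN mulmx1 mulNmx.
  by rewrite mulVmx// coordK//; exact: to_chart_unit.
apply: (continuous_eq_cst (C2 _ Up)) => [N nN|y Sy].
  exact: dense_chart_image dS Up nN.
have [dy Sy' _] := chart_imageP Sy.
rewrite mul_endo_in_chart; last by case: Sy => q [dq _] <-; exists q.
by rewrite /endo_in_chart JJ'// J'2// mulmxN mulmx1 mulNmx mulVmx//; exact: to_chart_unit.
Qed.

End Tensors.

(** * Density of the locally free points *)

(** Chain rule for the inclusion of a slice, whose derivative along [v] is [(0, v)]. It yields the
    smoothness of each [act a] from the joint smoothness of the action. *)
Lemma Ck_slice (R : realType) (V W Z : normedModType R) k (U' : set (V * W))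
    (U : set W) (F : V * W -> Z) (a : V) :
  open U -> (forall y, U y -> U' (a, y)) -> Ck k U' F -> Ck k U (fun y => F (a, y)).
Proof.
move=> oU UU'; have dp y : differentiable (fun y : W => (a, y)) y.
  by apply: differentiable_pair; [exact: differentiable_cst | exact: ex_diff].
have Dp y v : 'D_v (fun y : W => (a, y)) y = (0, v).
  rewrite deriveE// diff_pair; [|exact: differentiable_cst|exact: ex_diff].
  by rewrite diff_cst diff_val.
elim: k F => [|k IH] F.
  move=> cF y Uy; apply: (@continuous_comp _ _ _ (fun y : W => (a, y)) F).
    exact: (differentiable_continuous (dp y)).
  exact: (cF _ (UU' y Uy)).
move=> [dF DF]; split=> [y Uy|v].
  exact: (differentiable_comp (dp y) (dF _ (UU' y Uy))).
apply: (@Ck_eq R W Z k U (fun y => 'D_(0, v) F (a, y))) => [//|y Uy|]; last first.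
  exact: (IH _ (DF (0, v))).
have := derive_comp v (dp y) (dF _ (UU' y Uy)); rewrite Dp -deriveE; last exact: dF (UU' y Uy).
by move=> <-.
Qed.

(** Mean value theorem for each component on an interval around [s]. *)
Lemma derive0_locally_cst (R : realType) n (f : R -> 'rV[R]_n) (s : R) :
  (\forall u \near s, is_derive u (1 : R) f 0) -> \forall u \near s, f u = f s.
Proof.
move=> /nbhs_ballP[r /= r0 Hr]; apply/nbhs_ballP; exists r => //= u su.
have key a b : a <= b -> ball s r a -> ball s r b -> f a = f b.
  move=> ab sa sb; apply/rowP => j; apply/esym/eqP; rewrite -subr_eq0; apply/eqP.
  have bl c : a <= c <= b -> ball s r c.
    move: sa sb; rewrite -ball_normE /= !ltr_norml => /andP[? ?] /andP[? ?] /andP[? ?].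
    by apply/andP; split; lra.
  have df c : a <= c <= b -> is_derive c 1 (fun t => f t 0 j) 0.
    move=> /bl /Hr [d e]; apply: DeriveDef; first exact: (derivable_mxP f c 1).1.
    by have := congr1 (fun v : 'rV[R]_n => v 0 j) e; rewrite derive_mx// !mxE.
  have [||c _] := @MVT_segment R (fun t => f t 0 j) (fun=> 0) a b ab.
  - by move=> c; rewrite in_itv /= => /andP[c1 c2]; apply: df; rewrite !ltW.
  - apply: derivable_within_continuous => c; rewrite in_itv /= => cab.
    by have [] := df c cab.
  - by rewrite mul0r.
have [us|/ltW us] := leP u s; first by apply: key => //; exact: ballxx.
by apply/esym/key => //; exact: ballxx.
Qed.

(** * Torus actions: one-parameter orbits and fixed points of involutions *)

Section Action.
Context {R : realType} {m : nat} {M : topologicalType} {X : manifold R (m + m) M}.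
Context {act : 'rV[R]_m -> M -> M} (hact : effective_torus_action X act).

Lemma act_joint_continuous : continuous (fun z : 'rV[R]_m * M => act z.1 z.2).
Proof. by case: hact => -[]. Qed.

Lemma act0 p : act 0 p = p. Proof. by case: hact. Qed.

Lemma actD a b p : act (a + b) p = act a (act b p). Proof. by case: hact. Qed.

Lemma act_effective a : (forall p, act a p = p) <->
  exists z : 'rV[int]_m, a = map_mx (fun k : int => k%:~R) z.
Proof. by case: hact. Qed.

Lemma act_continuous a : continuous (act a).
Proof.
move=> p; apply: (@continuous_comp _ _ _ (fun p : M => (a, p))
  (fun z : 'rV[R]_m * M => act z.1 z.2)); last exact: act_joint_continuous.
exact: (cvg_pair (cvg_cst a) cvg_id).
Qed.

Lemma act_continuousl p : continuous (act ^~ p).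
Proof.
move=> a; apply: (@continuous_comp _ _ _ (fun a : 'rV[R]_m => (a, p))
  (fun z : 'rV[R]_m * M => act z.1 z.2)); last exact: act_joint_continuous.
exact (@cvg_pair _ _ _ (nbhs a) (nbhs a) (nbhs p) _ _ _ id (cst p)
  (@cvg_id _ (nbhs a)) (cvg_cst p)).
Qed.

Definition act_chart a (i j : chart X) (y : 'rV[R]_(m + m)) : 'rV[R]_(m + m) :=
  coord j (act a (icoord i y)).

Lemma open_act_preimage a (j : chart X) : open (act a @^-1` dom j).
Proof. by apply: open_comp => [p _|]; [exact: act_continuous | exact: open_dom]. Qed.

Lemma smooth_act_chart a (i j : chart X) :
  smooth_on (chart_image i (act a @^-1` dom j)) (act_chart a i j).
Proof.
move=> k; have oU := open_chart_image (i := i) (open_act_preimage a j).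
have [_ sm] : smooth_action X act by case: hact.
apply: (Ck_slice (a := a) oU _ (sm i j k)).
by move=> y /chart_imageP[dy ay cy]; split => //=; exists (icoord i y).
Qed.

Lemma differentiable_act_chart a (i j : chart X) p : dom i p -> dom j (act a p) ->
  differentiable (act_chart a i j) (coord i p).
Proof.
by move=> dp da; have [d _] := smooth_act_chart a i j 1; apply: d; exists p.
Qed.

Lemma jacobian_act k (f : M -> 'rV[R]_k) a (i j : chart X) p :
  dom i p -> dom j (act a p) -> differentiable (f \o icoord j) (coord j (act a p)) ->
  jacobian ((f \o act a) \o icoord i) (coord i p) =
    jacobian (act_chart a i j) (coord i p) *m jacobian (f \o icoord j) (coord j (act a p)).
Proof.
move=> dp da df.
have dt := differentiable_act_chart dp da.
have cj : act_chart a i j (coord i p) = coord j (act a p) by rewrite /act_chart coordK.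
rewrite -cj in df.
have E : \forall y \near coord i p,
    ((f \o icoord j) \o act_chart a i j) y = ((f \o act a) \o icoord i) y.
  have nd : nbhs p (act a @^-1` dom j).
    by apply: open_nbhs_nbhs; split=> //; exact: open_act_preimage.
  have := near_icoord dp nd.
  by apply: filterS => y dy /=; rewrite /act_chart coordK.
have dc := differentiable_comp dt df.
rewrite (jacobian_eq E dc).
by have e := jacobian_comp dt df; rewrite cj in e; rewrite -[RHS]e.
Qed.

(** Ensures that [fundamental_field] is a genuine derivative. *)
Lemma differentiable_orbit x (i : chart X) q : dom i q ->
  differentiable (fun s : R => coord i (act (s *: x) q)) 0.
Proof.
move=> dq; have [_ sm] : smooth_action X act by case: hact.
have [d _] := sm i i 1%N.
have dq0 : dom i (act (0 *: x) (icoord i (coord i q))).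
  by rewrite scale0r act0 coordK.
have d1 : differentiable (fun s : R => (s *: x, coord i q)) 0.
  by apply: differentiable_pair; [exact: ex_diff | exact: differentiable_cst].
have d2 := d (0 *: x, coord i q) (conj (chart_image_coord dq I) dq0).
have := differentiable_comp d1 d2.
by rewrite /comp /= coordK.
Qed.

(** The group law transports the zero velocity at time 0 to all times, so the orbit is locally
    constant, hence constant because the real line is connected. *)
Lemma fixed_by_line x q : fundamental_field X act x q = 0 ->
  forall s : R, act (s *: x) q = q.
Proof.
move=> K0; pose i := chart_at X q; have dq : dom i q := dom_chart_at X q.
pose c (s : R) := coord i (act (s *: x) q).
have dc : differentiable c 0 := differentiable_orbit x dq.
have Dc : 'D_1 c 0 = 0 by rewrite -derive1E.
have c0 : c 0 = coord i q by rewrite /c scale0r act0.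
have cl : continuous (fun s : R => act (s *: x) q).
  move=> s; apply: (@continuous_comp _ _ _ (fun s : R => s *: x) (act ^~ q)).
    exact: scalel_continuous.
  exact: act_continuousl.
have loc (s : R) : \forall u \near s, act (u *: x) q = act (s *: x) q.
  pose j := chart_at X (act (s *: x) q).
  have dj : dom j (act (s *: x) q) := dom_chart_at X _.
  have nd : \forall u \near s, dom j (act (u *: x) q).
    by apply: cl; exact: near_dom.
  suff : \forall u \near s, coord j (act (u *: x) q) = coord j (act (s *: x) q).
    move=> E; near=> u.
    have du : dom j (act (u *: x) q) by near: u.
    by rewrite -(coordK du) -(coordK dj); congr (icoord j _); near: u.
  apply: (@derive0_locally_cst _ _ (fun u => coord j (act (u *: x) q)) s).
  near=> u.
  have du : dom j (act (u *: x) q) by near: u.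
  have dF : differentiable (act_chart (u *: x) i j) (c 0).
    by rewrite c0; exact: differentiable_act_chart.
  have dFc := differentiable_comp dc dF.
  have sh : differentiable (fun t : R => t - u) u.
    by apply: differentiableB; [exact: ex_diff | exact: differentiable_cst].
  have dsh : 'D_1 (fun t : R => t - u) u = 1.
    rewrite (_ : (fun t => _) = id - cst u)// deriveB; [|exact: derivable_id|exact: derivable_cst].
    by rewrite derive_id derive_cst subr0.
  have u0 : u - u = 0 by rewrite subrr.
  rewrite -u0 in dFc.
  have dall := differentiable_comp sh dFc.
  (* Near time [u] the orbit is the image under [act (u *: x)] of the orbit near time 0, where the
     velocity vanishes by hypothesis. *)
  have E : \forall t \near u, ((act_chart (u *: x) i j \o c) \o (fun t => t - u)) t =
      coord j (act (t *: x) q).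
    have ni : \forall h \near (0 : R), dom i (act (h *: x) q).
      by apply: cl; rewrite scale0r act0; exact: near_dom.
    have : \forall t \near u, dom i (act ((t - u) *: x) q).
      have cs : {for u, continuous (fun t : R => t - u)}.
        exact: differentiable_continuous.
      have cs' : t - u @[t --> u] --> (0 : R).
        by rewrite -[X in _ --> X]u0; exact: cs.
      exact: (cs' _ ni).
    apply: filterS => t dt; rewrite /= /act_chart /c coordK// -actD -scalerDl.
    by rewrite addrC subrK.
  apply: near_eq_is_derive E _; apply: DeriveDef; first exact: diff_derivable.
  rewrite (derive_comp _ sh dFc) dsh u0 -deriveE; last by rewrite -u0.
  by rewrite (derive_comp _ dc dF) Dc linear0.
have clo : [set s : R | act (s *: x) q = q] = [set: R].
  apply: connected_clopen.
  - by apply/connected_intervalP.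
  - by exists 0; rewrite /= scale0r act0.
  - rewrite openE => s /= sq; have := loc s.
    by rewrite sq.
  - rewrite -[X in closed X]setCK; apply: open_closedC; rewrite openE => s /= sq.
    by have := loc s; apply: filterS => u e /=; rewrite e.
by move=> s; have : [set: R] s by []; rewrite -clo.
Unshelve. all: by end_near. Qed.


(** In a chart, [g = f - id] satisfies [g (f y) = - g y]; comparing its values at [f y] and [y] with
    Lipschitz constant 1/2 gives [2 |g y| <= |g y| / 2], hence [g y = 0]. *)
Lemma involution_fixed_near a p :
  (forall q, act a (act a q) = q) -> closure (interior [set q | act a q = q]) p ->
  act a p = p -> \forall q \near p, act a q = q.
Proof.
move=> inv clp ap; pose i := chart_at X p; have dp : dom i p := dom_chart_at X p.
pose f := act_chart a i i.
pose U := chart_image i (act a @^-1` dom i).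
have oU : open U := open_chart_image (i := i) (open_act_preimage a i).
have Up : U (coord i p) by exists p => //; split=> //=; rewrite ap.
have nU : nbhs (coord i p) U by exact: open_nbhs_nbhs.
have fp : f (coord i p) = coord i p by rewrite /f /act_chart coordK// ap.
have [df Df] := smooth_act_chart a i i 1%N.
pose g y := f y - y.
have dg y : U y -> differentiable g y.
  by move=> Uy; apply: differentiableB; [exact: df | exact: ex_diff].
have Dg v y : U y -> 'D_v g y = 'D_v f y - v.
  move=> Uy; rewrite (_ : g = f - id)// deriveB; [|by apply: diff_derivable; exact: df|exact: derivable_id].
  by rewrite derive_id.
have Dgc v : {for coord i p, continuous ('D_v g)}.
  have E : \forall y \near coord i p, 'D_v f y - v = 'D_v g y.
    by near=> y; rewrite Dg//; near: y.
  apply: (near_eq_continuous E); apply: continuousB; last exact: cst_continuous.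
  exact: (Df v).
(* The derivatives of [g] are continuous and vanish at interior fixed points, which accumulate at
   [p]. *)
have Dg0 v : 'D_v g (coord i p) = 0.
  pose S := chart_image i (interior [set q | act a q = q] `&` act a @^-1` dom i).
  apply: (@continuous_eq_cst _ _ _ _ _ S _ (Dgc v)) => [N nN|y Sy].
    have : nbhs p ((dom i `&` coord i @^-1` N) `&` act a @^-1` dom i).
      apply: filterI; first by apply: filterI; [exact: near_dom | exact: near_coord].
      by apply: open_nbhs_nbhs; split; [exact: open_act_preimage | rewrite /= ap].
    move=> /clp[q [Sq [[dq Nq] aq]]].
    by exists (coord i q); split=> //; exists q.
  have oS : open S.
    apply: open_chart_image; apply: openI; [exact: open_interior | exact: open_act_preimage].
  rewrite (@derive_eq_on _ _ _ S g (cst 0) v y oS) ?derive_cst// => z.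
  move=> /chart_imageP[dz [/interior_subset /= az _] cz].
  by rewrite /g /f /act_chart az cz subrr.
have half0 : (0 : R) < 2^-1 by rewrite invr_gt0.
have [|r r0 Lr] := small_lipschitz half0 _ Dgc Dg0.
  by near=> y; apply: dg; near: y.
have fc : {for coord i p, continuous f}.
  by apply: differentiable_continuous; exact: df.
have nf : \forall y \near coord i p, ball (coord i p) r (f y).
  by apply: fc; rewrite fp; exact: nbhsx_ballx.
have nr : \forall y \near coord i p, ball (coord i p) r y by exact: nbhsx_ballx.
suff E : \forall y \near coord i p, f y = y.
  have nE := near_coord dp E.
  have ni : nbhs p (dom i) := near_dom dp.
  have nai : \forall q \near p, dom i (act a q).
    by apply: open_nbhs_nbhs; split; [exact: open_act_preimage | rewrite /= ap].
  near=> q.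
  have dq : dom i q by near: q.
  have daq : dom i (act a q) by near: q.
  have e : f (coord i q) = coord i q by near: q.
  rewrite /f /act_chart (coordK dq) in e.
  by rewrite -(coordK daq) e (coordK dq).
near=> y.
have Uy : U y by near: y.
have [dy ay cy] := chart_imageP Uy.
have ffy : f (f y) = y by rewrite /f /act_chart coordK// inv cy.
have gf : g (f y) = - g y by rewrite /g ffy opprB.
have by1 : ball (coord i p) r y by near: y.
have by2 : ball (coord i p) r (f y) by near: y.
have := Lr _ _ by2 by1; rewrite gf -/(g y).
have -> : - g y - g y = - 2 *: g y by rewrite -opprD -mulr2n scaleNr scaler_nat.
rewrite normrZ normrN ger0_norm// => h.
apply/eqP; rewrite -subr_eq0 -normr_le0 -/(g y).
by move: h (normr_ge0 (g y)); lra.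
Unshelve. all: by end_near. Qed.

Context (hM : hausdorff_space M) (cM : connected [set: M]).

(** The interior of the fixed-point set is closed by [involution_fixed_near]; if nonempty it is all
    of [M], and effectiveness makes [a] integral. *)
Lemma involution_no_interior a : (exists z : 'rV[int]_m, a + a = map_mx intr z) ->
  ~ (exists z : 'rV[int]_m, a = map_mx intr z) ->
  interior [set q | act a q = q] = set0.
Proof.
move=> ha na; apply: contrapT => /eqP/set0P[q0 iq0].
have inv q : act a (act a q) = q.
  by rewrite -actD; apply: (act_effective (a + a)).2.
have cF : closed [set q | act a q = q].
  exact: (@closed_equalizer M M (act a) id hM (@act_continuous a) (fun _ => cvg_id)).
apply: na; apply/act_effective => q.
have E : interior [set q | act a q = q] = [set: M].
  apply: connected_clopen => //; [by exists q0|exact: open_interior|].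
  move=> p clp; have ap : act a p = p.
    by apply: cF; apply: closure_subset clp; exact: interior_subset.
  exact: involution_fixed_near.
have : interior [set q | act a q = q] q by rewrite E.
exact: interior_subset.
Qed.

Lemma half_vector_double (b : 'rV[bool]_m) :
  exists z : 'rV[int]_m, half_vector b + half_vector b = map_mx intr z :> 'rV[R]_m.
Proof.
exists (\row_j (b 0 j)%:Z); apply/rowP => j; rewrite !mxE -pmulrn.
by rewrite -mulrDl -mulr2n -[X in X / _]mulr_natr mulfK.
Qed.

Lemma half_vector_not_int (b : 'rV[bool]_m) : b != const_mx false ->
  ~ (exists z : 'rV[int]_m, half_vector b = map_mx intr z :> 'rV[R]_m).
Proof.
move=> /eqP b0 [z bz]; apply: b0; apply/rowP => j; rewrite mxE.
have := congr1 (fun v : 'rV[R]_m => v 0 j) bz; rewrite !mxE.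
case: (b 0 j) => // e.
have : (1 : int)%:~R = (2 * z 0 j)%:~R :> R by rewrite rmorphM /= -e mulrCA mulfV ?mulr1.
by move/eqP; rewrite eqr_int => /eqP; lia.
Qed.

(** The stabilizer of a point is closed and contains the integral vectors; if it contains a line, it
    contains a nonzero half vector. So it suffices to avoid finitely many closed sets with empty
    interior. *)
Lemma dense_locally_free :
  dense [set p | forall x : 'rV[R]_m, (forall s : R, act (s *: x) p = p) -> x = 0].
Proof.
pose G (b : 'rV[bool]_m) : set M :=
  if b == const_mx false then setT else ~` [set q | act (half_vector b) q = q].
have oG b : open (G b).
  rewrite /G; case: ifP => _; first exact: openT.
  apply: closed_openC.
  exact: (@closed_equalizer M M (act _) id hM (@act_continuous _) (fun _ => cvg_id)).
have dG b : dense (G b).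
  rewrite /G; case: ifP => [_ O [p Op] _|/negbT b0 O [p Op] oO]; first by exists p.
  apply: contrapT => /nonemptyPn h.
  have i0 := involution_no_interior (half_vector_double b) (half_vector_not_int b0).
  have : interior [set q | act (half_vector b) q = q] p.
    rewrite /interior; apply: filterS (open_nbhs_nbhs (conj oO Op)) => q Oq /=.
    apply: contrapT => nq.
    by have : (O `&` ~` [set q | act (half_vector b) q = q]) q by []; rewrite h.
  by rewrite i0.
(* Openness is carried along the induction, since the intersection of two dense sets is dense when
   one of them is open. *)
have key (s : seq 'rV[bool]_m) : open [set p | forall b, b \in s -> G b p] /\
    dense [set p | forall b, b \in s -> G b p].
  elim: s => [|b s [os ds]].
    have -> : [set p | forall b, b \in [::] -> G b p] = setT by apply/seteqP; split.
    by split; [exact: openT | move=> O [p Op] _; exists p].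
  have -> : [set p | forall b', b' \in b :: s -> G b' p] =
      G b `&` [set p | forall b, b \in s -> G b p].
    apply/seteqP; split=> [p h|p [h1 h2] b'].
      by split=> [|b' bs]; apply: h; rewrite inE ?eqxx ?bs ?orbT.
    by rewrite inE => /orP[/eqP ->|]; [exact: h1 | exact: h2].
  by split; [exact: openI | exact: denseI].
have [_ dA] := key (enum 'rV[bool]_m).
move=> O O0 oO; have [p [Op Gp]] := dA O O0 oO.
exists p; split=> //= x xp; apply: contrapT => /eqP x0.
have [||||b b0 Sb] := @closed_subgroup_half_vector R m [set a | act a p = p] x _ _ _ x0.
- by apply: (closed_equalizer hM); [exact: act_continuousl | exact: cst_continuous].
- move=> a b /= ap bp; rewrite actD.
  suff -> : act (- b) p = p by [].
  by rewrite -{1}bp -actD addNr act0.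
- by move=> z /=; apply: (act_effective _).2; exists z.
- exact: xp.
by have := Gp b (mem_enum _ b); rewrite /G (negbTE b0).
Qed.

End Action.

(** * Moment coordinates *)

(* In the frame dual to (dmu, dt), J is anti-diagonal with blocks P^T and
   - P^-T, and K J^* is [P^-1, *] because K w = - D^T; the hypothesis on the row
   spaces forces the second block to vanish. *)
Lemma correction_antidiagonal (F : fieldType) (m : nat) (J J0 w : 'M[F]_(m + m))
    (D E : 'M[F]_(m + m, m)) (K : 'M[F]_(m, m + m)) (P P0 : 'M[F]_m) :
  let H := usubmx (invmx (row_mx D E)) in
  row_mx D E \in unitmx -> w \in unitmx -> w^T = - w ->
  K *m D = 0 -> K *m E = 1%:M -> K *m w = - D^T ->
  J = D *m P^T *m K - E *m (invmx P)^T *m H ->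
  J0 = D *m P0^T *m K - E *m (invmx P0)^T *m H ->
  J *m J = - 1%:M ->
  (K *m (invmx w *m J *m w)^T <= K *m J)%MS ->
  correction J w D (P0 - P) (P^T *m invmx P0 *m P - P^T) = J0.
Proof.
move=> H Gu wu wT KD KE Kw JE J0E J2 sub.
have HG : H *m row_mx D E = row_mx 1%:M 0.
  by rewrite mul_usub_mx mulVmx// scalar_mx_block block_mxEv col_mxKu.
have [HD HE] : H *m D = 1%:M /\ H *m E = 0.
  by move: HG; rewrite mul_mx_row => /eq_row_mx.
have KG : K *m row_mx D E = row_mx 0 1%:M by rewrite mul_mx_row KD KE.
(* The rows of [H] and [K] form the frame dual to the columns of [D] and [E]; this is the
   corresponding resolution of the identity. *)
have one : D *m H + E *m K = 1%:M.
  rewrite -mul_row_col; apply: mulmx1C.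
  by rewrite mul_col_row HD HE KD KE -scalar_mx_block.
have JD : J *m D = - (E *m (invmx P)^T).
  by rewrite JE mulmxBl -!mulmxA KD HD !mulmx0 mulmx1 sub0r.
have HJ : H *m J = P^T *m K.
  by rewrite JE mulmxBr !mulmxA HD HE !mul0mx mul1mx subr0.
have KJ : K *m J = - ((invmx P)^T *m H).
  by rewrite JE mulmxBr !mulmxA KD KE !mul0mx mul1mx sub0r.
(* As [invmx] returns a singular matrix unchanged, invertibility has to be proved: [J *m J = - 1%:M]
   gives [P^T *m (invmx P)^T = 1%:M]. *)
have Pu : P \in unitmx.
  have : H *m (J *m J) *m D = - 1%:M by rewrite J2 mulmxN mulmx1 mulNmx HD.
  rewrite mulmxA HJ -!mulmxA JD !mulmxN [K *m _]mulmxA KE mul1mx => /oppr_inj.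
  by move=> /mulmx1_unit[]; rewrite unitmx_tr.
have wD : invmx w *m D = K^T.
  have -> : D = w *m K^T.
    by have := congr1 trmx Kw; rewrite trmx_mul linearN /= trmxK wT mulNmx => /oppr_inj.
  by rewrite mulKmx.
have DW : D^T *m invmx w = - K.
  by have := congr1 (fun Z => Z *m invmx w) Kw; rewrite /= mulmxK// mulNmx => ->; rewrite opprK.
set L := K *m (invmx w *m J *m w)^T in sub.
have LE : L = K *m w *m J^T *m invmx w.
  rewrite /L !trmx_mul trmx_inv wT.
  have -> : invmx (- w) = - invmx w.
    by apply: invmx_uniq; rewrite mulmxN mulNmx opprK mulmxV.
  by rewrite mulNmx !mulmxN opprK !mulmxA.
have LD : L *m D = invmx P.
  rewrite LE -mulmxA wD Kw mulNmx mulNmx -!trmx_mul JD.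
  by rewrite mulmxN linearN /= opprK mulmxA KE mul1mx trmxK.
have LE0 : L *m E = 0.
  have /submxP[C ->] := sub.
  by rewrite KJ mulmxN mulNmx -!mulmxA HE !mulmx0 oppr0.
have LH : L = invmx P *m H.
  by rewrite -[LHS]mulmx1 -one mulmxDr !mulmxA LD LE0 mul0mx addr0.
rewrite /correction mulmxDl opprD addrA.
(* Since [K *m w = - D^T], the factor [D^T *m J^T *m invmx w] is [- L]. *)
have -> : J *m D *m (P^T *m invmx P0 *m P - P^T)^T *m D^T *m J^T *m invmx w =
    - (J *m D *m (P^T *m invmx P0 *m P - P^T)^T *m L).
  by rewrite LE Kw !mulNmx !mulmxN opprK !mulmxA.
rewrite -[_ *m D^T *m invmx w]mulmxA DW mulmxN !opprK LH JD.
have -> : J + D *m (P0 - P)^T *m K = D *m P0^T *m K - E *m (invmx P)^T *m H.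
  by rewrite JE linearB /= mulmxBr mulmxBl addrC addrA subrK.
(* This explains the shape of (C2): multiplied by the transposed inverse of [P] on the left and by
   its inverse on the right, the transposed matrix becomes the difference of the transposed inverses
   of [P0] and [P]. *)
have e2 : E *m (invmx P)^T *m (P^T *m invmx P0 *m P - P^T)^T *m (invmx P *m H) =
    E *m (invmx P0)^T *m H - E *m (invmx P)^T *m H.
  rewrite linearB /= !trmx_mul !trmxK mulmxBr mulmxBl !mulmxA.
  rewrite -(mulmxA E (invmx P)^T P^T) -trmx_mul mulmxV// trmx1 mulmx1.
  by rewrite !mulmxK.
by rewrite J0E !mulNmx e2 opprB addrA subrK.
Qed.

Lemma jacobian_row_mx (R : realType) n a b (h : 'rV[R]_n -> 'rV[R]_(a + b)) x
    (f : 'rV[R]_n -> 'rV[R]_a) (g : 'rV[R]_n -> 'rV[R]_b) :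
  (forall y, h y = row_mx (f y) (g y)) -> differentiable h x ->
  [/\ differentiable f x, differentiable g x &
      jacobian h x = row_mx (jacobian f x) (jacobian g x)].
Proof.
move=> hE dh.
have fE i : (fun y => h y 0 (lshift b i)) = (fun y => f y 0 i).
  by apply/funext => y; rewrite hE row_mxEl.
have gE i : (fun y => h y 0 (rshift a i)) = (fun y => g y 0 i).
  by apply/funext => y; rewrite hE row_mxEr.
have df : differentiable f x.
  by apply: differentiable_mx => i j; rewrite (ord1 i) -fE; exact: differentiable_entry.
have dg : differentiable g x.
  by apply: differentiable_mx => i j; rewrite (ord1 i) -gE; exact: differentiable_entry.
split=> //; apply/matrixP => i j; rewrite jacobian_entry// derive_entry//.
case: (split_ordP j) => k ->.
  by rewrite row_mxEl fE jacobian_entry// derive_entry.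
by rewrite row_mxEr gE jacobian_entry// derive_entry.
Qed.

(** Differentiating [Z \o Y = id] at [q] exhibits an inverse of the Jacobian. *)
Lemma local_coordinates_unit (R : realType) n (M : topologicalType) (X : manifold R n M)
    (U : set M) (Y : M -> 'rV[R]_n) q : local_coordinates X U Y -> U q ->
  differentiable (Y \o icoord (chart_at X q)) (base X q) /\
  jacobian (Y \o icoord (chart_at X q)) (base X q) \in unitmx.
Proof.
move=> [oU sY _ [Z [ZY _ sZ]]] Uq; pose i := chart_at X q.
have dq : dom i q := dom_chart_at X q.
have dY : differentiable (Y \o icoord i) (coord i q) := smooth_map_differentiable sY dq Uq.
split=> //.
have YE : (Y \o icoord i) (coord i q) = Y q by rewrite /= coordK.
have dZ : differentiable (coord i \o Z) ((Y \o icoord i) (coord i q)).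
  by have [d _] := sZ i 1%N; rewrite YE; apply: d; split; [exists q | rewrite ZY].
have E : \forall y \near coord i q, ((coord i \o Z) \o (Y \o icoord i)) y = id y.
  have nU : nbhs q U by exact: open_nbhs_nbhs.
  have n1 := near_icoord dq nU; have n2 := near_icoord_coord dq.
  near=> y; rewrite /= ZY; last by near: y.
  by near: y.
have e := jacobian_comp dY dZ.
have dc := differentiable_comp dY dZ.
rewrite -(jacobian_eq E dc) jacobian_id in e.
exact: (mulmx1_unit (esym e)).1.
Unshelve. all: by end_near. Qed.

(** * Matrix form of the moment map equations, and density of the open part *)

Section Toric.
Context {R : realType} {m : nat} {M : topologicalType} {X : manifold R (m + m) M}.
Context {w : M -> 'M[R]_(m + m)} {act : 'rV[R]_m -> M -> M} {mu : M -> 'cV[R]_m}.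
Context (htoric : compact_symplectic_toric X w act mu).
Context (xi : 'M[R]_m).

Lemma toric_effective : effective_torus_action X act. Proof. by case: htoric. Qed.
Lemma toric_symplectic : symplectic_form X w. Proof. by case: htoric. Qed.
Lemma toric_moment : moment_map X w act mu. Proof. by case: htoric. Qed.
Lemma toric_smooth_mu : smooth_map X setT mu. Proof. by case: toric_moment. Qed.
Lemma toric_unit p : w p \in unitmx. Proof. by case: toric_symplectic. Qed.
Lemma toric_tr p : (w p)^T = - w p. Proof. by case: toric_symplectic. Qed.

Lemma mucoordE (x : 'M[R]_m) p : mucoord mu x p = (x *m mu p)^T.
Proof. by apply/rowP => j; rewrite mxE /pairing -row_mul [LHS]mxE [RHS]mxE. Qed.

Lemma smooth_mucoord x : smooth_map X setT (mucoord mu x).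
Proof.
move=> i k; have oU := open_chart_image (i := i) (@openT M).
apply: (@Ck_eq _ _ _ _ _ (fun y => (x *m (mu \o icoord i) y)^T)) => //.
  by move=> y _; rewrite /= mucoordE.
apply: (Ck_trmx oU); apply: (Ck_mulmx oU); first exact: Ck_cst.
exact: toric_smooth_mu.
Qed.

Definition dmu_mx (p : M) : 'M[R]_(m + m, m) :=
  jacobian (mucoord mu xi \o icoord (chart_at X p)) (base X p).

Lemma differentiable_mucoord x (i : chart X) p : dom i p ->
  differentiable (mucoord mu x \o icoord i) (coord i p).
Proof. by move=> dp; exact: smooth_map_differentiable (smooth_mucoord x) dp I. Qed.

Lemma dmap_mucoord_entry x j p v :
  dmap X (fun q => mucoord mu x q 0 j) p v =
  (v *m jacobian (mucoord mu x \o icoord (chart_at X p)) (base X p)) 0 j.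
Proof.
have dp := differentiable_mucoord x (dom_chart_at X p).
rewrite -derive_jacobian// derive_entry// deriveE//.
exact: (differentiable_entry 0 j dp).
Qed.

Lemma jacobian_mucoord x p :
  jacobian (mucoord mu x \o icoord (chart_at X p)) (base X p) =
  jacobian (mucoord mu 1%:M \o icoord (chart_at X p)) (base X p) *m x^T.
Proof.
have d1 := differentiable_mucoord 1%:M (dom_chart_at X p).
rewrite -(jacobian_mulmxr x^T d1).2; congr (jacobian _ _); apply/funext => y.
by rewrite /= !mucoordE mul1mx trmx_mul.
Qed.

Lemma mul_fundamental_field x p : fundamental_field X act x p *m w p =
  - (x *m (jacobian (mucoord mu 1%:M \o icoord (chart_at X p)) (base X p))^T).
Proof.
case: toric_moment => _ _ hm.
have d1 := differentiable_mucoord 1%:M (dom_chart_at X p).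
have [d2 e2] := jacobian_mulmxr x^T d1.
apply/rowP => i; have := hm x p (delta_mx 0 i).
rewrite {1}/bil trmx_delta -colE mxE => ->; rewrite [RHS]mxE; congr (- _).
have -> : (fun q => pairing (mu q) x) = (fun q => (mucoord mu 1%:M q *m x^T) 0 0).
  apply/funext => q; rewrite mucoordE mul1mx /pairing -trmx_mul.
  by rewrite [RHS]mxE.
have := derive_entry (delta_mx 0 i) 0 0 d2.
rewrite [RHS]deriveE; last exact: differentiable_entry d2.
rewrite derive_jacobian// e2 => e.
transitivity (((delta_mx 0 i : 'rV[R]_(m + m)) *m
    (jacobian (mucoord mu 1%:M \o icoord (chart_at X p)) (base X p) *m x^T)) 0 0).
  exact: (esym e).
by rewrite -rowE [LHS]mxE -[x *m _]trmxK trmx_mul trmxK [RHS]mxE.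
Qed.

Lemma Kdistribution_form p : Kdistribution X act xi p *m w p = - (dmu_mx p)^T.
Proof.
apply/row_matrixP => j; rewrite row_mul rowK mul_fundamental_field.
rewrite /dmu_mx (jacobian_mucoord xi) trmx_mul trmxK -row_mul.
apply/rowP => i; rewrite [LHS]mxE [RHS]mxE [RHS]mxE; congr (- _).
by rewrite mxE.
Qed.

(** The moment map is invariant, so its coordinates are constant along orbits; the left side is
    their derivative at time 0. *)
Lemma fundamental_field_mucoord x y p :
  fundamental_field X act y p *m
    jacobian (mucoord mu x \o icoord (chart_at X p)) (base X p) = 0.
Proof.
have dp : dom (chart_at X p) p := dom_chart_at X p.
have dc := differentiable_orbit toric_effective y dp.
have df := differentiable_mucoord x dp.
rewrite /fundamental_field derive1E.
have c0 : coord (chart_at X p) (act (0 *: y) p) = coord (chart_at X p) p.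
  by rewrite scale0r (act0 toric_effective).
rewrite /base -c0 in df *.
rewrite -diff_jacobian -(derive_comp _ dc df).
rewrite (_ : 'D_(1 : R) _ 0 = 'D_(1 : R) (cst (mucoord mu x p)) 0); first exact: derive_cst.
apply: (@near_eq_derive R R).
have n : \forall s \near (0 : R), dom (chart_at X p) (act (s *: y) p).
  have cc : continuous (fun s : R => act (s *: y) p).
    move=> s; apply: (@continuous_comp _ _ _ (fun s : R => s *: y) (act ^~ p)).
      exact: scalel_continuous.
    exact: (act_continuousl toric_effective).
  by apply: cc; rewrite scale0r (act0 toric_effective); exact: near_dom.
apply: filterS n => s ds; rewrite /= coordK// !mucoordE.
by case: toric_moment => _ -> _.
Qed.

Lemma Kdistribution_dmu p : Kdistribution X act xi p *m dmu_mx p = 0.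
Proof.
by apply/row_matrixP => j; rewrite row_mul rowK row0 fundamental_field_mucoord.
Qed.

Lemma open_open_part : open (open_part mu).
Proof.
apply: open_comp; last exact: open_interior.
by move=> p _; exact: (smooth_map_continuous toric_smooth_mu).
Qed.

Lemma dense_open_part : dense (open_part mu).
Proof.
case: htoric => -[hM _ cM] _ _ _ _.
have dfree := dense_locally_free toric_effective hM cM.
move=> O O0 oO; have [p [Op /= fp]] := dfree O O0 oO.
exists p; split=> //; rewrite /open_part /polytope /=.
pose f := mucoord mu 1%:M \o icoord (chart_at X p).
have dp : dom (chart_at X p) p := dom_chart_at X p.
have [L LG] : exists L, L *m jacobian f (base X p) = 1%:M.
  have : row_free (jacobian f (base X p))^T.
    (* For [x] in the kernel the moment map equation and non-degeneracy of [w] make the fundamental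
       field vanish at [p]; then the line of [x] fixes [p], so [x = 0] by the choice of [p]. *)
    rewrite -kermx_eq0; apply: contrapT => /negP/rowV0Pn[x /sub_kermxP xG] /eqP; apply.
    apply: fp; apply: (fixed_by_line toric_effective).
    suff e : fundamental_field X act x p *m w p = 0.
      by rewrite -[LHS](mulmxK (toric_unit p)) e mul0mx.
    by rewrite mul_fundamental_field xG oppr0.
  by move=> /row_freeP[B BE]; exists B^T; rewrite -trmx1 -BE trmx_mul trmxK.
have [df Df] := smooth_mucoord 1%:M (chart_at X p) 1%N.
have oU := open_chart_image (i := chart_at X p) (@openT M).
have nU : nbhs (base X p) (chart_image (chart_at X p) setT).
  by apply: open_nbhs_nbhs; split=> //; exists p.
have : nbhs (f (base X p)) (range f).
  apply: submersion_nbhs LG.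
    by near=> y; apply: df; near: y.
  by move=> v; apply: (Df v); exists p.
have fE : f (base X p) = (mu p)^T by rewrite /f /= coordK// mucoordE mul1mx.
rewrite fE => nf.
(* The submersion lemma concerns row vectors while [mu] takes column values; transposition carries
   the neighborhood over. *)
have ct : continuous (fun l : 'cV[R]_m => l^T).
  move=> l; apply: continuous_mx => i j.
  rewrite (_ : (fun y => _) = (fun y : 'cV[R]_m => y j i)); last by apply/funext => y; rewrite mxE.
  exact: matrix_normedtype.coord_continuous.
have nf' := ct (mu p) _ nf.
rewrite /interior /=.
near=> l; have [y _ /= fy] : (range f) l^T by near: l.
exists (icoord (chart_at X p) y) => //.
by apply: trmx_inj; rewrite -fy /f /= mucoordE mul1mx.
Unshelve. all: by end_near. Qed.

End Toric.

(** * The extension *)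

Section Extension.
Context {R : realType} {m : nat} {M : topologicalType} {X : manifold R (m + m) M}.
Context {w : M -> 'M[R]_(m + m)} {act : 'rV[R]_m -> M -> M} {mu : M -> 'cV[R]_m}.
Context (htoric : compact_symplectic_toric X w act mu).
Context (xi : 'M[R]_m).
Context (J : M -> 'M[R]_(m + m)) (A B : 'cV[R]_m -> 'M[R]_m).

Definition extension (p : M) : 'M[R]_(m + m) :=
  correction (J p) (w p) (dmu_mx (X := X) (mu := mu) xi p) (A (mu p)) (B (mu p)).

Lemma jacobian_mucoord_chart (i : chart X) p : dom i p ->
  jacobian (mucoord mu xi \o icoord i) (coord i p) =
  invmx (to_chart i p) *m dmu_mx (X := X) (mu := mu) xi p.
Proof.
move=> dp; have di := differentiable_mucoord htoric xi dp.
rewrite /dmu_mx (jacobian_transition (dom_chart_at X p) dp di).2.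
by rewrite mulKmx//; exact: to_chart_unit.
Qed.

(** By [correction_conj], the chart expression of [extension] is the correction built from the chart
    expressions of [J], [w] and the moment differentials, all of which are smooth. *)
Lemma smooth_extension_endo : smooth_on setT A -> smooth_on setT B ->
  smooth_endo X setT J -> smooth_endo X setT extension.
Proof.
move=> sA sB sJ i k; have oU := open_chart_image (i := i) (@openT M).
have [sw _ _ _] := toric_symplectic htoric.
have Cmu := toric_smooth_mu htoric i k.
have Cf (C : 'cV[R]_m -> 'M[R]_m) : smooth_on setT C ->
    Ck k (chart_image i setT) (C \o (mu \o icoord i)).
  by move=> sC; apply: (Ck_comp oU openT _ Cmu (sC k)).
apply: (@Ck_eq _ _ _ _ _ (fun y => correction (endo_in_chart i J y)
   (form_in_chart i w y) (jacobian (mucoord mu xi \o icoord i) y)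
   ((A \o (mu \o icoord i)) y) ((B \o (mu \o icoord i)) y))) => //.
  move=> _ [p [dp _] <-]; rewrite jacobian_mucoord_chart// endo_in_chart_coord//.
  rewrite /form_in_chart /endo_in_chart /= coordK//.
  rewrite correction_conj//; [exact: to_chart_unit | exact: (toric_unit htoric)].
apply: (Ck_correction oU).
- by move=> y Uy; apply: form_in_chart_unit => // p; exact: (toric_unit htoric).
- exact: sJ.
- exact: sw.
- by apply: (Ck_jacobian oU); exact: (smooth_mucoord htoric xi i).
- exact: Cf.
- exact: Cf.
Qed.

Lemma dmuE i p v : dmu X mu xi i p v = (v *m dmu_mx (X := X) (mu := mu) xi p) 0 i.
Proof. exact: (dmap_mucoord_entry htoric). Qed.

(** Identifies the form of (C3) with [w(., K .)]; the two minus signs from [Jform] cancel. *)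
Lemma extension_form p v v' :
  bil (w p) v (v' *m extension p) = corrected_form X w mu xi J A B p v v'.
Proof.
rewrite /bil trmx_mul mulmxA -[X in (X *m _) 0 0]mulmxA.
rewrite (mul_correction_tr _ _ _ _ (toric_tr htoric p) (toric_unit htoric p)).
rewrite mulmxDr mulmxDl [LHS]mxE /corrected_form; congr (_ + _).
  by rewrite /bil trmx_mul !mulmxA.
set D := dmu_mx _ _.
have quad (C : 'M[R]_m) (a a' : 'rV[R]_m) :
    (a *m C *m a'^T) 0 0 = \sum_i \sum_j C i j * (a 0 i * a' 0 j).
  rewrite mxE exchange_big /=; apply: eq_bigr => j _; rewrite !mxE mulr_suml.
  by apply: eq_bigr => i _; rewrite mulrAC mulrC mulrCA mulrA.
rewrite mulmxDr mulmxDl [LHS]mxE.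
under eq_bigr do under eq_bigr do rewrite !dmuE /Jform !dmuE mulrNN.
under eq_bigr do rewrite big_split /=.
rewrite big_split /= -/D -!quad; congr (_ + _).
  by rewrite trmx_mul !mulmxA.
by rewrite !trmx_mul !mulmxA.
Qed.

(** The tangent map of [act a] acts as a change of basis on [J], [w] and the moment differentials,
    while [A (mu p)] and [B (mu p)] are unchanged because [mu] is invariant. *)
Lemma extension_invariant : invariant_endo X act setT J -> invariant_endo X act setT extension.
Proof.
move=> iJ a p _; have := iJ a p I.
have iw : invariant_form X act w by case: htoric.
have := iw a p; set T := tangent_map X (act a) p; set q := act a p => wq JT.
have wpu := toric_unit htoric p.
have Tu : T \in unitmx by move: wpu; rewrite -wq !unitmx_mul => /andP[/andP[]].
have muq : mu q = mu p by have [_ h _] := toric_moment htoric; exact: h.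
have Dq : dmu_mx (X := X) (mu := mu) xi p = T *m dmu_mx (X := X) (mu := mu) xi q.
  have dp : dom (chart_at X p) p := dom_chart_at X p.
  have dq : dom (chart_at X q) q := dom_chart_at X q.
  have := jacobian_act (toric_effective htoric) dp dq (differentiable_mucoord htoric xi dq).
  rewrite (_ : mucoord mu xi \o act a = mucoord mu xi)//.
  apply/funext => r; rewrite /= !(mucoordE xi).
  by have [_ h _] := toric_moment htoric; rewrite h.
have wq' : w q = invmx T *m w p *m (invmx T)^T.
  rewrite -wq !mulmxA mulVmx// mul1mx -mulmxA -trmx_mul mulVmx//.
  by rewrite trmx1 mulmx1.
have Jq : J q = invmx T *m J p *m T by rewrite -mulmxA JT mulKmx.
have Dq' : dmu_mx (X := X) (mu := mu) xi q = invmx T *m dmu_mx (X := X) (mu := mu) xi p.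
  by rewrite Dq mulKmx.
rewrite /extension -/q muq Dq' wq' Jq correction_conj// !mulmxA mulmxV//.
by rewrite mul1mx.
Qed.

End Extension.

(** * The anti-diagonal form as a matrix identity *)

Section Antidiagonal.
Context {R : realType} {m : nat} {M : topologicalType} {X : manifold R (m + m) M}.
Context {w : M -> 'M[R]_(m + m)} {act : 'rV[R]_m -> M -> M} {mu : M -> 'cV[R]_m}.
Context (htoric : compact_symplectic_toric X w act mu).
Context (xi : 'M[R]_m) (J : M -> 'M[R]_(m + m)).
Context (U : set M) (u t : M -> 'rV[R]_m).
Context (ac : associated_coordinates X act mu xi J U u t).
Context (q : M).
Context (Uq : U q).

Definition dt_mx : 'M[R]_(m + m, m) :=
  jacobian (t \o icoord (chart_at X q)) (base X q).

Lemma momentum_frame : row_mx (dmu_mx (X := X) (mu := mu) xi q) dt_mx =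
    jacobian ((fun q' => row_mx (mucoord mu xi q') (t q')) \o icoord (chart_at X q)) (base X q).
Proof.
case: ac => _ _ _ _ lc; have [d _] := local_coordinates_unit lc Uq.
have [_ _ ->] := jacobian_row_mx (f := mucoord mu xi \o icoord (chart_at X q))
  (g := t \o icoord (chart_at X q)) (fun y => erefl) d.
by [].
Qed.

Lemma momentum_frame_unit : row_mx (dmu_mx (X := X) (mu := mu) xi q) dt_mx \in unitmx.
Proof.
by rewrite momentum_frame; case: ac => _ _ _ _ lc; have [_ ] := local_coordinates_unit lc Uq.
Qed.

(** In the coordinates [(u, t)] the field [K_j] is the one dual to [dt^j]. *)
Lemma Kdistribution_dt : Kdistribution X act xi q *m dt_mx = 1%:M.
Proof.
case: ac => _ lc _ cf _; have [d Gu] := local_coordinates_unit lc Uq.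
have [_ _ GE] := jacobian_row_mx (f := u \o icoord (chart_at X q))
  (g := t \o icoord (chart_at X q)) (fun y => erefl) d.
have KE : Kdistribution X act xi q = dsubmx (invmx (jacobian
    ((fun q => row_mx (u q) (t q)) \o icoord (chart_at X q)) (base X q))).
  apply/row_matrixP => j; rewrite rowK row_dsubmx.
  by have [_ <-] := cf q j Uq.
have := congr1 (fun Z => Z *m jacobian
  ((fun q => row_mx (u q) (t q)) \o icoord (chart_at X q)) (base X q)) KE.
rewrite /= mul_dsub_mx mulVmx// scalar_mx_block block_mxEv col_mxKd {1}GE.
by rewrite mul_mx_row => /eq_row_mx[].
Qed.

Lemma antidiagonal_mx (P : 'M[R]_m) (K : M -> 'M[R]_(m + m)) :
  antidiagonal_at X mu xi t P K q ->
  K q = dmu_mx (X := X) (mu := mu) xi q *m P^T *m Kdistribution X act xi q -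
    dt_mx *m (invmx P)^T *m usubmx (invmx (row_mx (dmu_mx (X := X) (mu := mu) xi q) dt_mx)).
Proof.
move=> h; set G := row_mx _ _; have Gu : G \in unitmx := momentum_frame_unit.
(* The [K_j] annihilate the moment differentials and are dual to the [dt^j], so they are also the
   fields [d/dt^j] of the coordinates [(mu, t)]. *)
have KE : Kdistribution X act xi q = dsubmx (invmx G).
  have KG : Kdistribution X act xi q *m G = row_mx 0 1%:M.
    rewrite mul_mx_row; congr (row_mx _ _); first exact: (Kdistribution_dmu htoric).
    exact: Kdistribution_dt.
  rewrite -[LHS](mulmxK Gu) KG -[in LHS](vsubmxK (invmx G)).
  by rewrite mul_row_col mul0mx add0r mul1mx.
have [_ lc _ _ lc'] := ac; have [d _] := local_coordinates_unit lc' Uq.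
have [_ dt _] := jacobian_row_mx (f := mucoord mu xi \o icoord (chart_at X q))
  (g := t \o icoord (chart_at X q)) (fun y => erefl) d.
have dE j v : dmap X (fun q' => t q' 0 j) q v = (v *m dt_mx) 0 j.
  rewrite -derive_jacobian// derive_entry// deriveE//.
  exact: (differentiable_entry 0 j dt).
have lin (C : 'M[R]_m) (a : 'rV[R]_m) (N : 'M[R]_(m, m + m)) :
    \sum_i \sum_j (C i j * a 0 j) *: row i N = a *m C^T *m N.
  rewrite mulmx_sum_row; apply: eq_bigr => i _.
  rewrite -scaler_suml; congr (_ *: _); rewrite mxE.
  by apply: eq_bigr => j _; rewrite mxE mulrC.
apply/row_matrixP => k; rewrite !rowE; move: (delta_mx 0 k) => v.
rewrite h mulmxBr !mulmxA KE -!lin; congr (_ - _).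
  apply: eq_bigr => i _; apply: eq_bigr => j _.
  by rewrite (dmap_mucoord_entry htoric) /coord_field -momentum_frame row_dsubmx.
apply: eq_bigr => i _; apply: eq_bigr => j _.
by rewrite dE /coord_field -momentum_frame row_usubmx.
Qed.

End Antidiagonal.

Theorem theorem5 (R : realType) (m : nat) (M : topologicalType)
    (X : manifold R (m + m) M)
    (w : M -> 'M[R]_(m + m)) (act : 'rV[R]_m -> M -> M) (mu : M -> 'cV[R]_m)
    (xi : 'M[R]_m)
    (htoric : compact_symplectic_toric X w act mu)
    (hxi : xi \in unitmx)
    (J J0 : M -> 'M[R]_(m + m))
    (hJ : DGK X w act mu xi [set: M] J)
    (hJ0 : DGK X w act mu xi (open_part mu) J0)
    (Psi Psi0 : 'cV[R]_m -> 'M[R]_m)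
    (hcoord : forall p, open_part mu p ->
       exists (U : set M) (u t : M -> 'rV[R]_m),
         [/\ U p,
             associated_coordinates X act mu xi J U u t,
             forall q, U q -> antidiagonal_at X mu xi t (Psi (mu q)) J q &
             forall q, U q -> antidiagonal_at X mu xi t (Psi0 (mu q)) J0 q])
    (A B : 'cV[R]_m -> 'M[R]_m)
    (C1 : smooth_extension (polytope mu) (fun x => Psi0 x - Psi x) A)
    (C2 : smooth_extension (polytope mu)
            (fun x => (Psi x)^T *m invmx (Psi0 x) *m Psi x - (Psi x)^T) B)
    (C3 : forall p, ~ open_part mu p ->
            posdef (corrected_form X w mu xi J A B p)) :
  exists Jext : M -> 'M[R]_(m + m),
    DGK X w act mu xi [set: M] Jext /\
    forall p, open_part mu p -> Jext p = J0 p.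
Proof.
have [[[sJ J2] tJ iJ iJa invJ] dJ] := hJ.
have [[[sJ0 J02] tJ0 iJ0 iJ0a invJ0] dJ0] := hJ0.
have [sA AE] := C1; have [sB BE] := C2.
pose Jext : M -> 'M[R]_(m + m) := extension (X := X) (w := w) (mu := mu) xi J A B.
have sw : smooth_form X setT w by have [] := toric_symplectic htoric.
have wu := toric_unit htoric.
have oM0 := open_open_part htoric; have dM0 := dense_open_part htoric.
have sJext : smooth_endo X setT Jext by exact: (smooth_extension_endo htoric xi sA sB sJ).
have JextE p : open_part mu p -> Jext p = J0 p.
  move=> op; have [U [u [t [Up ac aJ aJ0]]]] := hcoord p op.
  rewrite /Jext /extension AE// BE//.
  (* Over the interior of the polytope [A] and [B] are the matrices of (C1) and (C2), so the
     pointwise identity applies with [Psi (mu p)] and [Psi0 (mu p)]. *)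
  apply: (correction_antidiagonal (E := dt_mx (X := X) t p)
    (K := Kdistribution X act xi p)).
  - exact (momentum_frame_unit ac Up).
  - exact: wu.
  - exact: (toric_tr htoric).
  - exact: (Kdistribution_dmu htoric).
  - exact: (Kdistribution_dt ac Up).
  - exact: (Kdistribution_form htoric).
  - exact: (antidiagonal_mx htoric ac Up (aJ p Up)).
  - exact: (antidiagonal_mx htoric ac Up (aJ0 p Up)).
  - exact: J2.
  (* The distribution condition in [DGK] for [J] supplies the inclusion of row spaces. *)
  - by have := dJ p op; rewrite /adjoint => ->.
have adjE p : open_part mu p -> adjoint w Jext p = adjoint w J0 p.
  by move=> op; rewrite /adjoint JextE.
exists Jext; split; last exact: JextE.
(* The distribution condition only concerns the open part, where the extension is [J0]. *)
split; last by move=> p op; rewrite adjE// JextE//; exact: dJ0.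
split.
- exact: (almost_complex_dense dM0 sJext JextE J02).
(* Tameness is not a closed condition: it comes from [J0] on the open part and from (C3)
   elsewhere. *)
- move=> p _; have [op|op] := pselect (open_part mu p).
    by rewrite JextE//; exact: tJ0.
  move=> v v0; rewrite (extension_form htoric).
  exact: C3.
- exact: (integrable_dense oM0 dM0 sJext JextE iJ0).
- exact: (integrable_dense oM0 dM0 (smooth_adjoint sw wu sJext) adjE iJ0a).
- exact: (extension_invariant htoric).
Qed.
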